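(* Let $U\subset\mathbb{R}^2$ be a bounded open set, $[t_0,t_1]\subset\mathbb{R}$ with $t_0<t_1$, and let $(\boldsymbol{v},\mathbf{B})$ be a smooth incompressible, electrically conducting two-dimensional (visco-resistive MHD) fluid flow on $U\times[t_0,t_1]$ with constant magnetic diffusivity $\eta\ge 0$, whose velocity field leaves $U$ invariant, with flow map $\mathbf{F}_{t_0}^t:U\to U$, magnetic scalar potential $a$ and electric current density $j_z=-\Delta a$ (all as specified in the context). Let $\mathbf{J}=\begin{pmatrix}0&-1\\1&0\end{pmatrix}$. Then: (i) (Eulerian) For each $t\in[t_0,t_1]$, the exact Eulerian barriers at time $t$ to the diffusive (resistive) transport of the magnetic field are the invariant manifolds of the autonomous differential equation (with $t$ fixed as a parameter) $$\boldsymbol{x}'(s)=\eta\,\mathbf{J}\,\nabla j_z(\boldsymbol{x}(s),t).$$ (ii) (Lagrangian) The (time-$t_0$ positions of the) exact Lagrangian barriers over $[t_0,t_1]$ to the diffusive (resistive) transport of the magnetic field are the invariant manifolds of the autonomous differential equation $$\boldsymbol{x}_0'(s)=\eta\,\mathbf{J}\,\nabla_0\,\overline{j_z(\boldsymbol{x}_0(s))},$$ where $$\overline{j_z(\boldsymbol{x}_0)}=\frac{1}{t_1-t_0}\int_{t_0}^{t_1}j_z\big(\mathbf{F}_{t_0}^t(\boldsymbol{x}_0),t\big)\,dt$$ is the temporal average of the electric current density along the fluid trajectory starting from $\boldsymbol{x}_0$ at time $t_0$, and $\nabla_0$ is the gradient with respect to $\boldsymbol{x}_0$.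
   Context: Two-dimensional incompressible MHD. The velocity field and the magnetic field are given by a streamfunction $\psi(\boldsymbol{x},t)$ and a magnetic scalar potential $a(\boldsymbol{x},t)$ (smooth scalar functions on $U\times[t_0,t_1]$) via $$\boldsymbol{v}=-\mathbf{J}\nabla\psi,\qquad \mathbf{B}=-\mathbf{J}\nabla a,\qquad \mathbf{J}=\begin{pmatrix}0&-1\\1&0\end{pmatrix}.$$ The scalar vorticity is $\omega=-\Delta\psi$ and the scalar electric current density is $j_z=j=-\Delta a$. The fields satisfy $$\partial_t\omega+\boldsymbol{v}\cdot\nabla\omega=\nu\Delta\omega+\mathbf{B}\cdot\nabla j,\qquad \partial_t a+\boldsymbol{v}\cdot\nabla a=\eta\Delta a,$$ where $\nu$ is the kinematic viscosity and $\eta$ the magnetic diffusivity (constants). The corresponding transport equation for the magnetic field is $$\frac{D\mathbf{B}}{Dt}=[\nabla\boldsymbol{v}]\mathbf{B}+\eta\Delta\mathbf{B},\qquad \nabla\cdot\mathbf{B}=0,$$ where $\frac{D}{Dt}=\partial_t+\boldsymbol{v}\cdot\nabla$ is the material derivative. The term $\eta\Delta\mathbf{B}$ is the diffusive part of the right-hand side. Flow map. Fluid trajectories solve $\dot{\boldsymbol{x}}=\boldsymbol{v}(\boldsymbol{x},t)$. $\mathbf{F}_{t_0}^t(\boldsymbol{x}_0)$ denotes the position at time $t$ of the trajectory that starts at $\boldsymbol{x}_0$ at time $t_0$. The set $U$ is invariant under the flow, and $\nabla\mathbf{F}_{t_0}^t(\boldsymbol{x}_0)$ is the Jacobian matrix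 of $\mathbf{F}_{t_0}^t$ with respect to $\boldsymbol{x}_0$. A material curve is a curve evolving as $\mathcal{M}(t)=\mathbf{F}_{t_0}^t(\mathcal{M}_0)$; it is identified with its initial position $\mathcal{M}_0$. Notation. For a time-dependent vector field $\boldsymbol{u}(\boldsymbol{x},t)$, its pullback to time $t_0$ is $$(\mathbf{F}_{t_0}^t)^*[\boldsymbol{u}(\boldsymbol{x}_0)]=[\nabla\mathbf{F}_{t_0}^t(\boldsymbol{x}_0)]^{-1}\boldsymbol{u}(\mathbf{F}_{t_0}^t(\boldsymbol{x}_0),t).$$ An overbar denotes the temporal average of a function of $(\boldsymbol{x}_0,t)$: $\overline{\boldsymbol{w}}(\boldsymbol{x}_0)=\frac{1}{t_1-t_0}\int_{t_0}^{t_1}\boldsymbol{w}(\boldsymbol{x}_0,t)\,dt$. Definition of exact barriers to the diffusive transport of the magnetic field. The exact Eulerian barriers at time $t$ are the invariant manifolds of the autonomous equation (with $t$ fixed) $$\boldsymbol{x}'(s)=\eta\,\Delta\mathbf{B}(\boldsymbol{x}(s),t).$$ The exact Lagrangian barriers over $[t_0,t_1]$ are the material curves whose initial positions $\mathcal{M}_0$ at time $t_0$ are invariant manifolds of the autonomous equation $$\boldsymbol{x}_0'(s)=\eta\,\overline{\det\big(\nabla\mathbf{F}_{t_0}^t(\boldsymbol{x}_0)\big)\,(\mathbf{F}_{t_0}^t)^*[\Delta\mathbf{B}(\boldsymbol{x}_0(s))]}.$$ Explicitly, the right-hand side of the last equation is the value at $\boldsymbol{x}_0=\boldsymbol{x}_0(s)$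 of the vector field $$\boldsymbol{x}_0\mapsto\frac{\eta}{t_1-t_0}\int_{t_0}^{t_1}\det\big(\nabla\mathbf{F}_{t_0}^t(\boldsymbol{x}_0)\big)\,[\nabla\mathbf{F}_{t_0}^t(\boldsymbol{x}_0)]^{-1}\,\Delta\mathbf{B}(\mathbf{F}_{t_0}^t(\boldsymbol{x}_0),t)\,dt.$$ Here an invariant manifold of an autonomous equation $\boldsymbol{x}'=\boldsymbol{f}(\boldsymbol{x})$ on $U$ means a codimension-one submanifold of $U$ (a smooth curve in two dimensions) that is everywhere tangent to the vector field $\boldsymbol{f}$. *)

(* Defs.v *)
From HB Require Import structures.
From mathcomp Require Import all_boot all_order all_algebra.
From mathcomp Require Import all_classical all_reals all_analysis.

Set Implicit Arguments.
Unset Strict Implicit.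
Unset Printing Implicit Defensive.

Import Order.TTheory GRing.Theory Num.Theory.
Import numFieldNormedType.Exports.

Local Open Scope classical_set_scope.
Local Open Scope ring_scope.

Notation plane R := 'cV[R]_2.

Section VectorCalculus.
Context {R : realType}.
Implicit Types (x y : plane R) (t : R).

Definition basis (i : 'I_2) : plane R := delta_mx i 0.

(* The rotation (0, -1; 1, 0). *)
Definition Jmx : 'M[R]_2 := delta_mx 1 0 - delta_mx 0 1.

Definition dot (u w : plane R) : R := (u^T *m w) 0 0.

Definition grad (f : plane R -> R) x : plane R := \col_i 'D_(basis i) f x.

Definition laplacian (f : plane R -> R) x : R :=
  \sum_(i < 2) 'D_(basis i) ('D_(basis i) f) x.

Definition vlaplacian (u : plane R -> plane R) x : plane R :=
  \col_i laplacian (fun y => u y i 0) x.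

(* Entry (i, j) is the j-th partial derivative of the i-th component; the
   library's [jacobian], which acts on row vectors, is the transpose. *)
Definition jac (f : plane R -> plane R) x : 'M[R]_2 :=
  \matrix_(i, j) 'D_(basis j) (fun y => f y i 0) x.

(* Derivatives relative to a subset D of the line: these are one-sided at the
   endpoints when D is a closed interval. *)
Definition diff_quot (V : normedModType R) (g : R -> V) t : R -> V :=
  fun s => (s - t)^-1 *: (g s - g t).

Definition is_derive_in (V : normedModType R) (D : set R) (g : R -> V) t (l : V) :=
  diff_quot g t s @[s --> within D t^'] --> l.

Definition derive_in (V : normedModType R) (D : set R) (g : R -> V) t : V :=
  lim (diff_quot g t s @[s --> within D t^']).

Definition derivable_in (V : normedModType R) (D : set R) (g : R -> V) t :=
  cvg (diff_quot g t s @[s --> within D t^']).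

(* [Some i] is the i-th space derivative, [None] the time derivative. *)
Definition pderiv t0 t1 (k : option 'I_2) (f : plane R -> R -> R) :
    plane R -> R -> R :=
  match k with
  | Some i => fun x t => 'D_(basis i) (f ^~ t) x
  | None => fun x t => derive_in `[t0, t1] (f x) t
  end.

(* C^infinity on U x [t0, t1]: the mixed partial derivatives of all orders, taken
   in any order (w is the word of differentiations), exist and are jointly
   continuous. *)
Definition smooth_on (U : set (plane R)) t0 t1 (f : plane R -> R -> R) : Prop :=
  forall w : seq (option 'I_2),
    let g := foldr (pderiv t0 t1) f w in
    {within U `*` `[t0, t1], continuous (fun z : plane R * R => g z.1 z.2)} /\
    (forall x t, U x -> t \in `[t0, t1] ->
       (forall i, derivable (g ^~ t) x (basis i)) /\
       derivable_in `[t0, t1] (g x) t).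

Definition tavg t0 t1 (h : R -> R) : R :=
  (t1 - t0)^-1 * \int[lebesgue_measure]_(t in `[t0, t1]) h t.

Definition vtavg t0 t1 (w : R -> plane R) : plane R :=
  \col_i tavg t0 t1 (fun t => w t i 0).

End VectorCalculus.

Section InvariantManifolds.
Context {R : realType}.
Implicit Types (U V M : set (plane R)) (f : plane R -> plane R).

(* g is a smooth regular parametrization on ]al, be[ of a relatively open piece
   of M, and a homeomorphism onto that piece. *)
Definition local_param M (al be : R) (g : R -> plane R) : Prop :=
  [/\ forall n s, s \in `]al, be[ -> derivable (derive1n n g) s 1,
      forall s, s \in `]al, be[ -> derive1 g s != 0 &
      exists V (sigma : plane R -> R),
        [/\ open V, V `&` M = g @` `]al, be[,
            {within V `&` M, continuous sigma} &
            forall s, s \in `]al, be[ -> sigma (g s) = s]].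

Definition smooth_curve M : Prop :=
  forall p, M p -> exists al be g s,
    [/\ local_param M al be g, s \in `]al, be[ & g s = p].

Definition tangent M (p w : plane R) : Prop :=
  exists al be g s c,
    [/\ local_param M al be g, s \in `]al, be[, g s = p & w = c *: derive1 g s].

Definition invariant_manifold U f M : Prop :=
  [/\ M `<=` U, smooth_curve M & forall p, M p -> tangent M p (f p)].

End InvariantManifolds.

Section MHD.
Context {R : realType}.
Implicit Types (U M : set (plane R)) (psi a : plane R -> R -> R).

(* The field - J grad f of a scalar potential f: the velocity for the
   streamfunction, the magnetic field for the magnetic potential. *)
Definition field_of (f : plane R -> R -> R) (x : plane R) (t : R) : plane R :=
  - (Jmx *m grad (f ^~ t) x).

(* - Delta f: the vorticity for the streamfunction, the electric current density
   for the magnetic potential. *)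
Definition neg_laplacian (f : plane R -> R -> R) (x : plane R) (t : R) : R :=
  - laplacian (f ^~ t) x.

Definition velocity psi := field_of psi.
Definition vorticity psi := neg_laplacian psi.
Definition magnetic a := field_of a.
Definition current a := neg_laplacian a.

Record mhd_flow U (t0 t1 nu eta : R) psi a : Prop := MhdFlow {
  mhd_psi_smooth : smooth_on U t0 t1 psi;
  mhd_a_smooth : smooth_on U t0 t1 a;
  mhd_vorticity : forall x t, U x -> t \in `[t0, t1] ->
    derive_in `[t0, t1] (vorticity psi x) t
      + dot (velocity psi x t) (grad (vorticity psi ^~ t) x)
    = nu * laplacian (vorticity psi ^~ t) x
      + dot (magnetic a x t) (grad (current a ^~ t) x);
  mhd_induction : forall x t, U x -> t \in `[t0, t1] ->
    derive_in `[t0, t1] (a x) t + dot (velocity psi x t) (grad (a ^~ t) x)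
    = eta * laplacian (a ^~ t) x }.

(* F t x0 is the position at time t of the trajectory of v issued from x0 at
   time t0; all these trajectories stay in U. *)
Definition flow_map U (t0 t1 : R) (v : plane R -> R -> plane R)
    (F : R -> plane R -> plane R) : Prop :=
  forall x0, U x0 ->
    F t0 x0 = x0 /\
    forall t, t \in `[t0, t1] ->
      U (F t x0) /\ is_derive_in `[t0, t1] (F ^~ x0) t (v (F t x0) t).

Definition pullback (F : R -> plane R -> plane R) (t : R)
    (u : plane R -> R -> plane R) (x0 : plane R) : plane R :=
  invmx (jac (F t) x0) *m u (F t x0) t.

Definition diffusive_term a (x : plane R) (t : R) : plane R :=
  vlaplacian (magnetic a ^~ t) x.

Definition eulerian_barrier U (eta : R) a (t : R) M : Prop :=
  invariant_manifold U (fun x => eta *: diffusive_term a x t) M.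

Definition lagrangian_field (t0 t1 eta : R) a (F : R -> plane R -> plane R)
    (x0 : plane R) : plane R :=
  eta *: vtavg t0 t1 (fun t =>
    \det (jac (F t) x0) *: pullback F t (diffusive_term a) x0).

(* A Lagrangian barrier is a material curve, i.e. an evolving curve t |-> M t. *)
Definition lagrangian_barrier U (t0 t1 eta : R) a (F : R -> plane R -> plane R)
    (M : R -> set (plane R)) : Prop :=
  exists M0, invariant_manifold U (lagrangian_field t0 t1 eta a F) M0 /\
    forall t, t \in `[t0, t1] -> M t = F t @` M0.

End MHD.

(* Main.v *)
(* Since J grad commutes with the Laplacian, eta Delta B = eta J grad j, which is
   the Eulerian part. For the Lagrangian part the flow map, known only through its
   differential equation, is shown to be differentiable in the initial position by
   proving, with Gronwall's inequality, that its difference quotients are uniformly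
   Cauchy in time; incompressibility makes the determinant of its Jacobian matrix A
   equal to 1. Then A J A^T = det(A) J gives det(A) A^-1 J grad j = J A^T grad j,
   and A^T grad j is the gradient of j o F by the chain rule, which commutes with
   the temporal average because the quotients converge uniformly in time. *)
Require Import Defs.
From HB Require Import structures.
From mathcomp Require Import all_boot all_order all_algebra.
From mathcomp Require Import all_classical all_reals all_analysis.
From mathcomp Require Import ring lra.

Set Implicit Arguments.
Unset Strict Implicit.
Unset Printing Implicit Defensive.

Import Order.TTheory GRing.Theory Num.Theory.
Import numFieldNormedType.Exports.

Local Open Scope classical_set_scope.
Local Open Scope ring_scope.

(* [basis] now denotes a notion of the topology library. *)
Local Notation ebasis := Defs.basis.

(** The velocity is controlled only on [U], which need not be convex, so no global Lipschitz
    constant is at hand. All estimates are therefore made in a tube around one trajectory, whose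
    radius comes from compactness of [[t0, t1]], and Gronwall's inequality is put in a form that
    also proves that a neighbouring trajectory stays in the tube. The Jacobian matrix of the flow is
    a limit taken at each time separately, with no a priori regularity in time. Hence no evolution
    equation is written for it: Liouville's formula and the chain rule are proved for difference
    quotients with a small step, which are differentiable in time like the flow itself, and are
    carried to the limit by bounds uniform in time. The averaged integrand gets its continuity in
    time in the same way. Outside [U] the limits that define derivatives may be default values, so
    fields are compared on [U] only. *)

Lemma ord2P (P : 'I_2 -> Prop) : P 0 -> P 1 -> forall i, P i.
Proof.
move=> P0 P1 i; case: (unliftP 0 i) => [j ->|-> //].
by rewrite (_ : lift 0 j = 1)//; apply: val_inj; rewrite /= ord1.
Qed.

Lemma norm_plane_lt (R : realType) (x : plane R) (e : R) :
  0 < e -> `|x| < e <-> forall i, `|x i 0| < e.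
Proof.
move=> e0; rewrite -[`|x|]/(mx_norm x) mx_normrE; split => [/bigmax_ltP[_ h] i|h].
  exact: (h (i, 0)).
by apply/bigmax_ltP; split => // -[i j] _ /=; rewrite ord1.
Qed.

(** * Continuity and derivatives relative to a subset *)

Section WithinContinuity.
Context {R : realType} {T : topologicalType}.
Implicit Types (A : set T) (f g : T -> R).

Lemma within_continuousD A f g : {within A, continuous f} ->
  {within A, continuous g} -> {within A, continuous (fun x => f x + g x)}.
Proof.
move=> /subspace_continuousP cf /subspace_continuousP cg.
by apply/subspace_continuousP => x Ax; apply: cvgD; [exact: cf|exact: cg].
Qed.

Lemma within_continuousB A f g : {within A, continuous f} ->
  {within A, continuous g} -> {within A, continuous (fun x => f x - g x)}.
Proof.
move=> /subspace_continuousP cf /subspace_continuousP cg.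
by apply/subspace_continuousP => x Ax; apply: cvgB; [exact: cf|exact: cg].
Qed.

Lemma within_continuousM A f g : {within A, continuous f} ->
  {within A, continuous g} -> {within A, continuous (fun x => f x * g x)}.
Proof.
move=> /subspace_continuousP cf /subspace_continuousP cg.
by apply/subspace_continuousP => x Ax; apply: cvgM; [exact: cf|exact: cg].
Qed.

Lemma within_continuous_cst A (c : R) : {within A, continuous (fun=> c)}.
Proof. by apply/subspace_continuousP => x Ax; exact: cvg_cst. Qed.

End WithinContinuity.

Section RelativeDerivatives.
Context {R : realType}.
Implicit Types (a b t l : R).

Lemma is_derive_in_continuous (V : normedModType R) (D : set R) (g l : R -> V) :
  (forall t, D t -> is_derive_in D g t (l t)) -> {within D, continuous g}.
Proof.
move=> h; apply/subspace_continuousP => t Dt.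
have ht := h t Dt.
have : g t + (s - t) *: diff_quot g t s @[s --> within D t^'] -->
    g t + (t - t) *: l t.
  apply: cvgD; first exact: cvg_cst.
  apply: cvgZ => //; apply: cvgB; last exact: cvg_cst.
  move=> A At.
  have : nbhs t (fun s => s != t -> D s -> A s) by apply: filterS At.
  by [].
rewrite subrr scale0r addr0 => /cvgrPdist_lt c; apply/cvgrPdist_lt => e e0.
have := c e e0; rewrite !near_withinE; apply: filterS => s hs Ds.
(* The punctured filter leaves out s = t, where the difference vanishes anyway. *)
have [->|st] := eqVneq s t; first by rewrite subrr normr0.
have := hs st Ds; rewrite /diff_quot scalerA divff ?subr_eq0// scale1r.
by rewrite [g t + _]addrC subrK.
Qed.

Lemma is_derive_in_coord (D : set R) (g : R -> plane R) t (l : plane R) i :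
  is_derive_in D g t l -> is_derive_in D (fun s => g s i 0) t (l i 0).
Proof.
move=> h; rewrite /is_derive_in.
rewrite (_ : diff_quot _ _ = (fun s => (diff_quot g t s) i 0)); last first.
  by apply/funext => s; rewrite /diff_quot !mxE.
have cc : (fun M : plane R => M i 0) @ l --> l i 0 by exact: coord_continuous.
exact: (cvg_comp _ _ h cc).
Qed.

(** The closed interval is a neighbourhood of an interior point, so the restriction of the filter is
    harmless there. This opens the two-sided derivative calculus; the endpoints are later handled by
    continuity alone. *)
Lemma is_derive_in_interior a b (g : R -> R) t l : t \in `]a, b[ ->
  is_derive_in `[a, b] g t l -> is_derive t 1 g l.
Proof.
move=> tab h.
have c : h^-1 *: (g (h *: 1 + t) - g t) @[h --> 0^'] --> l.
  apply/cvgrPdist_lt => e e0.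
  move/cvgrPdist_lt: h => /(_ e e0); rewrite !near_withinE.
  move=> /nbhs_normP[d d0 hd].
  have [r r0 hr] : exists2 r, 0 < r & forall s, `|t - s| < r -> s \in `[a, b].
    have /nbhs_normP[r r0 hr] := near_in_itvoo tab.
    by exists r => // s /hr/=; exact: subset_itv_oo_cc.
  apply/nbhs_normP; exists (Num.min d r); first by rewrite /= lt_min d0.
  move=> k/=; rewrite sub0r normrN lt_min => /andP[kd kr] k0.
  have kE : `|t - (k + t)| = `|k| by rewrite opprD addrCA subrr addr0 normrN.
  have := hd (k + t); rewrite /= kE => /(_ kd).
  rewrite /diff_quot addrK [k *: 1]mulr1; apply.
    by rewrite -subr_eq0 addrK.
  by apply: hr; rewrite kE.
apply: DeriveDef; last exact/cvg_lim.
by apply/cvg_ex; exists l.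
Qed.

End RelativeDerivatives.

(** * Mean value bound and Gronwall's inequality *)

Section MeanValue.
Context {R : realType}.
Implicit Types (a b t l L c : R).

Lemma is_derive_bound a b (f df : R -> R) c : 0 <= c ->
  (forall t, t \in `]a, b[ -> is_derive t 1 f (df t)) ->
  {within `[a, b], continuous f} ->
  (forall t, t \in `]a, b[ -> `|df t| <= c) ->
  forall t, t \in `[a, b] -> `|f t - f a| <= c * (b - a).
Proof.
move=> c0 fd fc fb t tab.
have [at_ tb] : a <= t /\ t <= b by move: tab; rewrite in_itv/= => /andP[].
have sub x : x \in `]a, t[ -> x \in `]a, b[.
  by rewrite !in_itv/= => /andP[-> /lt_le_trans]; apply.
have [<-|ne] := eqVneq a t.
  by rewrite subrr normr0 mulr_ge0// subr_ge0 (le_trans at_).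
have [s hs ->] : exists2 s, s \in `]a, t[ & f t - f a = df s * (t - a).
  apply: MVT; first by rewrite lt_neqAle ne.
    by move=> x /sub; exact: fd.
  by apply: continuous_subspaceW fc; apply: subset_itvl; rewrite bnd_simp.
rewrite normrM ler_pM// ?fb ?sub//.
by rewrite ger0_norm ?subr_ge0// lerD2r.
Qed.

Lemma gronwall a b L c (z dz : R -> R) : 0 <= L -> 0 <= c -> 0 <= z a ->
  (forall t, t \in `]a, b[ -> is_derive t 1 z (dz t)) ->
  {within `[a, b], continuous z} ->
  (forall t, t \in `]a, b[ -> dz t <= L * z t + c) ->
  forall t, t \in `[a, b] -> z t <= (z a + c * (b - a)) * expR (L * (b - a)).
Proof.
move=> L0 c0 za0 zd zc zb t tab.
have [at_ tb] : a <= t /\ t <= b by move: tab; rewrite in_itv/= => /andP[].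
(* The integrating factor removes [L * z]. As it is at most 1 to the right of [a], subtracting
   [c * (s - a)] compensates for [c], and [w] is nonincreasing. *)
pose w s := z s * expR (- (L * (s - a))) - c * (s - a).
have wd s : s \in `]a, b[ -> is_derive s 1 w
    (z s *: (expR (- (L * (s - a))) * - L) +
     expR (- (L * (s - a))) *: dz s - c).
  move=> sab; have ? := zd s sab.
  have e1 : is_derive s 1 (fun s => - (L * (s - a))) (- L).
    apply: is_derive_eq.
    by rewrite subr0 [L *: 1]mulr1.
  have e2 := @is_derive1_comp _ expR _ s _ _ (is_derive_expR _) e1.
  have ? : is_derive s 1 (fun s => expR (- (L * (s - a))))
    (expR (- (L * (s - a))) * - L) by exact: e2.
  apply: is_derive_eq.
  by rewrite subr0 [c *: 1]mulr1.
have wle : w t <= w a.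
  apply: (@ler0_derive1_le_cc _ w a b).
  - by move=> x /wd[].
  - move=> s sab; rewrite derive1E (@derive_val _ _ _ _ _ _ _ (wd s sab)).
    have := zb s sab; set E := expR _ => h.
    have E1 : E <= 1.
      rewrite -expR0 ler_expR oppr_le0 mulr_ge0// subr_ge0.
      by move: sab; rewrite in_itv/= => /andP[/ltW].
    have E0 : 0 <= E by exact: expR_ge0.
    rewrite /GRing.scale/=; nra.
  - have lin (k : R) : continuous (fun s : R => k * (s - a)).
      move=> s; apply: (@continuousM _ _ (fun=> k) (fun s => s - a) s).
        exact: cvg_cst.
      by apply: (@continuousB _ _ _ id (fun=> a) s); [exact: cvg_id|exact: cvg_cst].
    have ec : {within `[a, b], continuous (fun s => expR (- (L * (s - a))))}.
      apply: continuous_subspaceT => s.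
      apply: (@continuous_comp _ _ _ (fun s => - (L * (s - a))) expR).
        exact: continuousN (lin L s).
      exact: continuous_expR.
    have lc : {within `[a, b], continuous (fun s => c * (s - a))}.
      exact: continuous_subspaceT (lin c).
    by apply: within_continuousB => //; exact: within_continuousM.
  - by [].
  - by rewrite in_itv/= lexx (le_trans at_ tb).
  - by [].
move: wle; rewrite /w subrr !mulr0 ?oppr0 expR0 mulr1 addr0 lerBlDr => h.
have hc : z t * expR (- (L * (t - a))) <= z a + c * (b - a).
  by apply: (le_trans h); rewrite lerD2l ler_wpM2l// lerD2r.
have -> : z t = z t * expR (- (L * (t - a))) * expR (L * (t - a)).
  by rewrite -mulrA -expRD addNr expR0 mulr1.
apply: (le_trans (ler_wpM2r (expR_ge0 _) hc)).
apply: ler_wpM2l; first by rewrite addr_ge0// mulr_ge0// subr_ge0 (le_trans at_).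
by rewrite ler_expR ler_wpM2l// lerD2r.
Qed.

End MeanValue.

(** Bootstrap: before the first time [s] at which [z] reaches [r] the differential inequality is
    available, so Gronwall bounds [z s] by a number smaller than [r], a contradiction. *)
Lemma gronwall_threshold (R : realType) (a b L c r : R) (z dz : R -> R) :
  0 <= L -> 0 <= c -> 0 <= z a ->
  (forall t, t \in `]a, b[ -> is_derive t 1 z (dz t)) ->
  {within `[a, b], continuous z} ->
  (forall t, t \in `]a, b[ -> z t < r -> dz t <= L * z t + c) ->
  (z a + c * (b - a)) * expR (L * (b - a)) < r ->
  forall t, t \in `[a, b] -> z t <= (z a + c * (b - a)) * expR (L * (b - a)).
Proof.
move=> L0 c0 za0 zd zc zb zr.
suff zlt t : t \in `[a, b] -> z t < r.
  apply: gronwall => // t tab; apply: zb => //; apply: zlt.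
  exact: subset_itv_oo_cc tab.
move=> tab; rewrite ltNge; apply/negP => rz.
pose S := [set s | s \in `[a, b] /\ r <= z s].
have St : S t by [].
have hiS : has_inf S.
  split; first by exists t.
  by exists a => s [+ _]; rewrite in_itv/= => /andP[].
pose s := inf S.
have st : s <= t by apply: ge_inf => //; exact: hiS.2.
have as_ : a <= s.
  apply: lb_le_inf; first by exists t.
  by move=> u [+ _]; rewrite in_itv/= => /andP[].
have tb : t <= b by move: tab; rewrite in_itv/= => /andP[].
have sb : s <= b := le_trans st tb.
have sab : s \in `[a, b] by rewrite in_itv/= as_.
(* By continuity the infimum itself belongs to [S]: otherwise [z] would stay below [r] just to the
   right of [s]. *)
have zs : r <= z s.
  rewrite leNgt; apply/negP => zs.
  move/subspace_continuousP : zc => /(_ s sab)/cvgrPdist_lt.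
  have rz0 : 0 < r - z s by rewrite subr_gt0.
  move=> /(_ _ rz0); rewrite near_withinE => /nbhs_normP[d /= d0 hd].
  have [u [uab ru] us] := inf_adherent d0 hiS.
  have su : s <= u by apply: ge_inf => //; exact: hiS.2.
  have := hd u; rewrite /= distrC ger0_norm ?subr_ge0// ltrBlDl => /(_ us uab).
  by rewrite distrC => /ltr_normlW; rewrite ltrBlDr subrK ltNge ru.
suff : z s <= (z a + c * (b - a)) * expR (L * (b - a)).
  by rewrite leNgt (lt_le_trans zr zs).
have sub u : u \in `]a, s[ -> u \in `]a, b[.
  by rewrite !in_itv/= => /andP[-> /lt_le_trans]; apply.
have zsa : z s <= (z a + c * (s - a)) * expR (L * (s - a)).
  apply: (gronwall L0 c0 za0 (z := z) (dz := dz)).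
  - by move=> u /sub; exact: zd.
  - by apply: continuous_subspaceW zc; apply: subset_itvl; rewrite bnd_simp.
  - move=> u uas; apply: zb; first exact: sub.
    rewrite ltNge; apply/negP => ru.
    have : S u by split => //; apply: subset_itv_oo_cc; exact: sub.
    move=> /(ge_inf hiS.2); rewrite leNgt.
    by move: uas; rewrite in_itv/= => /andP[_ ->].
  - by rewrite in_itv/= as_ lexx.
apply: (le_trans zsa); apply: ler_pM.
- by rewrite addr_ge0// mulr_ge0// subr_ge0.
- exact: expR_ge0.
- by rewrite lerD2l ler_wpM2l// lerD2r.
- by rewrite ler_expR ler_wpM2l// lerD2r.
Qed.

(** * Directional derivatives and the symmetry of second derivatives *)

Section DirectionalDerivatives.
Context {R : realType} {V : normedModType R}.
Implicit Types (g : V -> R) (x u v : V) (h s : R).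

Lemma is_derive_line g x v s : derivable g (x + s *: v) v ->
  is_derive s 1 (fun s => g (x + s *: v)) ('D_v g (x + s *: v)).
Proof.
move=> dg.
have E : (fun h => h^-1 *: (((fun s => g (x + s *: v)) \o shift s) (h *: 1)
      - g (x + s *: v))) =
    (fun h => h^-1 *: ((g \o shift (x + s *: v)) (h *: v) - g (x + s *: v))).
  apply/funext => h /=; congr (_ *: (g _ - _)).
  by rewrite [h *: 1]mulr1 scalerDl addrCA.
by apply: DeriveDef; rewrite /derivable /derive E.
Qed.

Lemma MVT_line g x v h :
  (forall s, `|s| <= `|h| -> derivable g (x + s *: v) v) ->
  exists2 s, `|s| <= `|h| &
    g (x + h *: v) - g x = h * 'D_v g (x + s *: v).
Proof.
move=> dg; have d s hs := is_derive_line (dg s hs).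
have [h0|h0] := leP 0 h.
  have sh s : s \in `[0, h] -> `|s| <= `|h|.
    by rewrite in_itv/= => /andP[s0 sh]; rewrite !ger0_norm.
  have [||s hs E] := @MVT_segment _ (fun s => g (x + s *: v))
      (fun s => 'D_v g (x + s *: v)) 0 h h0.
    by move=> s /subset_itv_oo_cc/sh; exact: d.
    apply: derivable_within_continuous => s /sh hs; exact: (@ex_derive _ _ _ _ _ _ _ (d s hs)).
  exists s; first exact: sh.
  by move: E; rewrite scale0r addr0 subr0 mulrC.
have sh s : s \in `[h, 0] -> `|s| <= `|h|.
  rewrite in_itv/= => /andP[hs s0]; rewrite !ler0_norm ?lerN2//; exact: ltW.
have [||s hs E] := @MVT_segment _ (fun s => g (x + s *: v))
    (fun s => 'D_v g (x + s *: v)) h 0 (ltW h0).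
  by move=> s /subset_itv_oo_cc/sh; exact: d.
  apply: derivable_within_continuous => s /sh hs; exact: (@ex_derive _ _ _ _ _ _ _ (d s hs)).
exists s; first exact: sh.
move: E; rewrite scale0r addr0 sub0r => E.
by rewrite -opprB E mulrN opprK mulrC.
Qed.

Lemma derivable_shift g c x v :
  derivable g (x + c) v -> derivable (fun z => g (z + c)) x v.
Proof. by rewrite /derivable/=; under eq_fun do rewrite addrA. Qed.

Lemma derive_shiftE g c x v : 'D_v (fun z => g (z + c)) x = 'D_v g (x + c).
Proof. by rewrite /derive/=; under eq_fun do rewrite -addrA. Qed.

(** The second difference is the increment along u of the map sending z to g (z + h v) - g z. The
    mean value theorem in direction u, then in direction v, turns it into a mixed derivative at a
    nearby point. *)
Lemma mixed_difference g x u v (d : R) :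
  0 < d -> (forall z, `|x - z| < d ->
    [/\ derivable g z u & derivable ('D_u g) z v]) ->
  forall h, 0 < h -> h * (`|u| + `|v|) < d ->
  exists2 z, `|x - z| <= h * (`|u| + `|v|) &
    g (x + h *: u + h *: v) - g (x + h *: u) - (g (x + h *: v) - g x)
      = h * (h * 'D_v ('D_u g) z).
Proof.
move=> d0 dg h h0 hd.
have inb s t : `|s| <= `|h| -> `|t| <= `|h| ->
    `|x - (x + s *: u + t *: v)| <= h * (`|u| + `|v|).
  rewrite (gtr0_norm h0) => sh th.
  rewrite -addrA opprD addrA subrr add0r normrN (le_trans (ler_normD _ _))//.
  by rewrite mulrDr !normrZ lerD// ler_wpM2r.
pose G z := g (z + h *: v) - g z.
have inbu s : `|s| <= `|h| -> `|x - (x + s *: u)| < d.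
  move=> sh; apply: le_lt_trans hd.
  by have := inb s 0 sh; rewrite scale0r addr0; apply; rewrite normr0.
have inbuv s : `|s| <= `|h| -> `|x - (x + s *: u + h *: v)| < d.
  by move=> sh; apply: le_lt_trans hd; exact: inb.
have dGs s : `|s| <= `|h| -> is_derive (x + s *: u) u G
    ('D_u g (x + s *: u + h *: v) - 'D_u g (x + s *: u)).
  move=> sh.
  have d1 := (dg _ (inbuv s sh)).1; have d2 := (dg _ (inbu s sh)).1.
  have d1' := derivable_shift d1.
  apply: DeriveDef; first exact: derivableB.
  by rewrite (deriveB d1' d2) derive_shiftE.
have [s sh Es] := @MVT_line G x u h (fun s sh => @ex_derive _ _ _ _ _ _ _ (dGs s sh)).
have [t th Et] := @MVT_line ('D_u g) (x + s *: u) v h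
  (fun t th => (dg _ (le_lt_trans (inb s t sh th) hd)).2).
exists (x + s *: u + t *: v); first exact: inb.
rewrite -[LHS]/(G (x + h *: u) - G x) Es (@derive_val _ _ _ _ _ _ _ (dGs s sh)).
by rewrite Et.
Qed.

(** Schwarz's theorem. The second difference is symmetric in u and v, so the two mixed derivatives
    agree at two points close to x; continuity at x does the rest. *)
Lemma derive_comm g x u v :
  (\forall z \near x, [/\ derivable g z u, derivable g z v,
    derivable ('D_u g) z v & derivable ('D_v g) z u]) ->
  {for x, continuous ('D_v ('D_u g))} -> {for x, continuous ('D_u ('D_v g))} ->
  'D_v ('D_u g) x = 'D_u ('D_v g) x.
Proof.
move=> /nbhs_normP[d /= d0 dg] cvu cuv.
apply/eqP; rewrite -subr_eq0 -normr_eq0 eq_le normr_ge0 andbT.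
apply/ler_addgt0Pl => e e0; rewrite addr0.
have close2 (p q r : R) : `|p - r| < e / 2 -> `|q - r| < e / 2 -> `|p - q| <= e.
  move=> pr qr; rewrite ltW// (le_lt_trans (ler_distD r _ _))// (splitr e).
  by rewrite ltrD// distrC.
have e2 : 0 < e / 2 by rewrite divr_gt0.
move/cvgrPdist_lt : cvu => /(_ _ e2)/nbhs_normP[d1 /= d10 h1].
move/cvgrPdist_lt : cuv => /(_ _ e2)/nbhs_normP[d2 /= d20 h2].
pose m := Num.min d (Num.min d1 d2).
have m0 : 0 < m by rewrite !lt_min d0 d10.
(* The added 1 keeps the denominator of [h] positive when both directions vanish. *)
have uv0 : 0 < `|u| + `|v| + 1 by rewrite ltr_wpDl// addr_ge0.
pose h := m / (`|u| + `|v| + 1).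
have h0 : 0 < h by rewrite divr_gt0.
have hm : h * (`|u| + `|v|) < m.
  by rewrite -mulrA -[ltRHS]mulr1 ltr_pM2l// mulrC ltr_pdivrMr// mul1r ltrDl.
move: (hm); rewrite !lt_min => /and3P[hd hd1 hd2].
have [z zx Ez] := @mixed_difference g x u v d d0
  (fun z zx => let: And4 a _ b _ := dg z zx in conj a b) h h0 hd.
have uvC : `|v| + `|u| = `|u| + `|v| := addrC _ _.
have hd' : h * (`|v| + `|u|) < d by rewrite uvC.
have hd2' : h * (`|v| + `|u|) < d2 by rewrite uvC.
have [w wx Ew] := @mixed_difference g x v u d d0
  (fun z zx => let: And4 _ a _ b := dg z zx in conj a b) h h0 hd'.
have E : 'D_v ('D_u g) z = 'D_u ('D_v g) w.
  apply: (mulfI (lt0r_neq0 h0)); apply: (mulfI (lt0r_neq0 h0)).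
  have swap (a b c k : R) : a - b - (c - k) = a - c - (b - k) by ring.
  rewrite (addrAC x (h *: v) (h *: u)) in Ew.
  by apply: (etrans (esym Ez)); apply: etrans Ew; exact: swap.
have A := h1 z (le_lt_trans zx hd1).
have B := eq_ind_r (fun q => `|_ - q| < e / 2) (h2 w (le_lt_trans wx hd2')) E.
exact: close2 A B.
Qed.

End DirectionalDerivatives.

(** * Vectors of the plane *)

Lemma sum_ord2 (V : nmodType) (f : 'I_2 -> V) : \sum_(i < 2) f i = f 0 + f 1.
Proof. by rewrite !big_ord_recl big_ord0 addr0; congr (_ + f _); apply: val_inj. Qed.

Section PlaneVectors.
Context {R : realType}.
Implicit Types (x w : plane R).

(** The library norm of the plane is the maximum norm; this sum norm is dual to a common bound on
    the partial derivatives, see [dlin_bound]. *)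
Definition norm1 w : R := `|w 0 0| + `|w 1 0|.

Lemma norm1_ge0 w : 0 <= norm1 w.
Proof. by rewrite addr_ge0. Qed.

Lemma plane_basisE w : w = w 0 0 *: (ebasis 0) + w 1 0 *: (ebasis 1).
Proof.
by apply/matrixP; apply: ord2P => j; rewrite ord1 !mxE/= ?mulr1 ?mulr0 ?addr0 ?add0r.
Qed.

Lemma coord_basis (i j : 'I_2) : (ebasis i : plane R) j 0 = (j == i)%:R.
Proof. by rewrite mxE andbT. Qed.

Lemma norm1_basis (i : 'I_2) : norm1 (ebasis i) = 1.
Proof. by move: i; apply: ord2P; rewrite /norm1 !coord_basis/= normr0 normr1 ?addr0 ?add0r. Qed.

Lemma norm1Z c w : norm1 (c *: w) = `|c| * norm1 w.
Proof. by rewrite /norm1 !mxE !normrM mulrDr. Qed.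

Lemma coord_le_norm1 w i : `|w i 0| <= norm1 w.
Proof. by move: i; apply: ord2P; rewrite /norm1 ?lerDl ?lerDr. Qed.

Lemma norm1_lt w d : norm1 w < d -> `|w| < d.
Proof.
move=> h; apply/norm_plane_lt; first exact: le_lt_trans (norm1_ge0 w) h.
by move=> i; exact: le_lt_trans (coord_le_norm1 w i) h.
Qed.

(** Leads back from the squared Euclidean length, which is differentiable in time, to the sum
    norm. *)
Lemma norm1_sqr_le w : norm1 w ^+ 2 <= 2 * (w 0 0 ^+ 2 + w 1 0 ^+ 2).
Proof.
rewrite -(real_normK (num_real (w 0 0))) -(real_normK (num_real (w 1 0))).
by rewrite /norm1; have := sqr_ge0 (`|w 0 0| - `|w 1 0|); nra.
Qed.

(** The path from x to y runs parallel to the axes and stays in the ball because the balls of the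
    maximum norm are squares. Each leg has its own intermediate point, so only partial derivatives
    enter. *)
Lemma MVT_plane (g : plane R -> R) x y (d : R) :
  (forall z, `|x - z| < d -> forall i, derivable g z (ebasis i)) ->
  `|x - y| < d ->
  exists p q, [/\ `|x - p| < d, `|x - q| < d &
    g y - g x = (y - x) 0 0 * 'D_(ebasis 0) g p + (y - x) 1 0 * 'D_(ebasis 1) g q].
Proof.
move=> dg xy; have d0 : 0 < d by apply: le_lt_trans xy.
pose w := y - x.
have wd i : `|w i 0| < d.
  by move: i; apply/norm_plane_lt => //; rewrite /w distrC.
have in0 s : `|s| <= `|w 0 0| -> `|x - (x + s *: (ebasis 0))| < d.
  move=> sw; rewrite opprD addNKr normrN; apply/norm_plane_lt => //.
  apply: ord2P; rewrite mxE coord_basis/= ?mulr1 ?mulr0 ?normr0//.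
  exact: le_lt_trans sw (wd 0).
have in1 s : `|s| <= `|w 1 0| -> `|x - (x + w 0 0 *: (ebasis 0) + s *: (ebasis 1))| < d.
  move=> sw; rewrite -addrA opprD addNKr normrN; apply/norm_plane_lt => //.
  apply: ord2P; rewrite !mxE/= ?mulr1 ?mulr0 ?addr0 ?add0r//.
    by have := wd 0; rewrite !mxE.
  exact: le_lt_trans sw (wd 1).
have [s sw Es] := @MVT_line _ _ g x (ebasis 0) (w 0 0) (fun s sw => dg _ (in0 s sw) 0).
have [t tw Et] := @MVT_line _ _ g (x + w 0 0 *: (ebasis 0)) (ebasis 1) (w 1 0)
  (fun s sw => dg _ (in1 s sw) 1).
exists (x + s *: (ebasis 0)), (x + w 0 0 *: (ebasis 0) + t *: (ebasis 1)).
split; [exact: in0|exact: in1|].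
have yE : x + w 0 0 *: ebasis 0 + w 1 0 *: ebasis 1 = y.
  by rewrite -addrA -(plane_basisE w) addrC subrK.
by rewrite -/w -Es -Et yE [RHS]addrC subrKA.
Qed.

End PlaneVectors.

(** * Fields on [U] times [[t0, t1]] near a trajectory *)

Section SpaceTime.
Context {R : realType} (U : set (plane R)) (t0 t1 : R).
Implicit Types (p : plane R -> R -> R) (X : R -> plane R).

Definition jointly_continuous p :=
  {within U `*` `[t0, t1], continuous (fun z : plane R * R => p z.1 z.2)}.

Definition space_C1 p :=
  jointly_continuous p /\ forall i,
    jointly_continuous (fun x t => 'D_(ebasis i) (p ^~ t) x) /\
    forall x t, U x -> t \in `[t0, t1] -> derivable (p ^~ t) x (ebasis i).

Lemma jointly_continuousN p :
  jointly_continuous p -> jointly_continuous (fun x t => - p x t).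
Proof.
move=> /subspace_continuousP cp; apply/subspace_continuousP => z zD.
by apply: cvgN; exact: cp.
Qed.

(** The differential of [p ^~ t] at x in direction w. *)
Definition dlin p x t (w : plane R) : R :=
  'D_(ebasis 0) (p ^~ t) x * w 0 0 + 'D_(ebasis 1) (p ^~ t) x * w 1 0.

Lemma dlinB p x t w w' : dlin p x t (w - w') = dlin p x t w - dlin p x t w'.
Proof. by rewrite /dlin !mxE !mulrBr opprD addrACA. Qed.

Lemma dlinZ p x t c w : dlin p x t (c *: w) = c * dlin p x t w.
Proof. by rewrite /dlin !mxE mulrDr !(mulrCA c). Qed.

Lemma dlin_bound p x t w K : (forall i, `|'D_(ebasis i) (p ^~ t) x| <= K) ->
  `|dlin p x t w| <= K * norm1 w.
Proof.
move=> hK; rewrite (le_trans (ler_normD _ _))// !normrM mulrDr.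
by rewrite lerD// ler_wpM2r.
Qed.

Hypothesis U_open : open U.

Lemma jointly_continuousP p : jointly_continuous p ->
  forall x t, U x -> t \in `[t0, t1] -> forall e, 0 < e ->
  exists2 r, 0 < r & forall y s, `|x - y| < r -> `|t - s| < r ->
    s \in `[t0, t1] -> U y /\ `|p x t - p y s| < e.
Proof.
move=> /subspace_continuousP cp x t Ux tI e e0.
have /cvgrPdist_lt/(_ _ e0) := cp (x, t) (conj Ux tI).
rewrite near_withinE => -[[A B]/= [/nbhs_normP[a /= a0 hA] /nbhs_normP[b /= b0 hB]] hAB].
have /nbhs_normP[u /= u0 hu] := open_nbhs_nbhs (conj U_open Ux).
exists (Num.min u (Num.min a b)); first by rewrite !lt_min u0 a0.
move=> y s; rewrite !lt_min => /and3P[yu ya _] /and3P[_ _ sb] sI.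
have Uy : U y by exact: hu.
by split => //; apply: (hAB (y, s)); [split; [exact: hA|exact: hB]|split].
Qed.

Section Along.
Variable X : R -> plane R.
Hypothesis X_cont : {within `[t0, t1], continuous X}.
Hypothesis X_in : forall t, t \in `[t0, t1] -> U (X t).

Lemma continuous_along p : jointly_continuous p ->
  {within `[t0, t1], continuous (fun t => p (X t) t)}.
Proof.
move=> cp; apply/subspace_continuousP => t tI; apply/cvgrPdist_lt => e e0.
have [r r0 hr] := jointly_continuousP cp (X_in tI) tI e0.
move/subspace_continuousP : X_cont => /(_ t tI)/cvgrPdist_lt/(_ _ r0).
rewrite !near_withinE => Xr.
have tr : \forall s \near t, `|t - s| < r.
  by apply/nbhs_normP; exists r.
apply: filterS2 Xr tr => s Xs ts sI.
by apply: (hr (X s) s (Xs sI) ts sI).2.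
Qed.

Lemma bounded_along p : jointly_continuous p ->
  exists2 K, 0 <= K & forall t, t \in `[t0, t1] -> `|p (X t) t| <= K.
Proof.
move=> /continuous_along cp.
have /compact_bounded/pinfty_ex_gt0[K K0 hK] : compact ((fun t => p (X t) t) @` `[t0, t1]).
  by apply: continuous_compact => //; exact: segment_compact.
by exists K; [exact: ltW|move=> t tI; apply: hK; exists t].
Qed.

(** Joint continuity gives a radius at each time; compactness of [[t0, t1]], in its near-covering
    form, makes one radius serve for all times. This is the tube of the later estimates. *)
Lemma uniform_along p : jointly_continuous p -> forall e, 0 < e ->
  exists2 d, 0 < d & forall t y, t \in `[t0, t1] -> `|X t - y| < d ->
    U y /\ `|p (X t) t - p y t| < e.
Proof.
move=> cp e e0.
have e2 : 0 < e / 2 by rewrite divr_gt0.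
have /compact_near_coveringP/near_covering_withinP cov := @segment_compact R t0 t1.
(* Near t, both [p (X t') t'] and [p y t'] are compared with the value at [(X t, t)], each up to
   [e / 2]. *)
have loc t : `[t0, t1]%classic t -> \forall t' \near t & d \near (0 : R)^'+,
    `[t0, t1]%classic t' -> forall y, `|X t' - y| < d ->
     U y /\ `|p (X t') t' - p y t'| < e.
  move=> tI; have [r r0 hr] := jointly_continuousP cp (X_in tI) tI e2.
  have r2 : 0 < r / 2 by rewrite divr_gt0.
  move/subspace_continuousP : X_cont => /(_ t tI)/cvgrPdist_lt/(_ _ r2).
  rewrite near_withinE => Xr.
  have tr : \forall s \near t, `|t - s| < r by apply/nbhs_normP; exists r.
  near=> t' d => t'I y yd.
  have ht : `|t - t'| < r by near: t'.
  have /(_ t'I) hX : `[t0, t1]%classic t' -> `|X t - X t'| < r / 2 by near: t'.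
  have dr : d < r / 2 by near: d; exact: nbhs_right_lt.
  have hy : `|X t - y| < r.
    rewrite (le_lt_trans (ler_distD (X t') _ _))// (splitr r) ltrD//.
    exact: lt_trans dr.
  have [Uy h1] := hr y t' hy ht t'I.
  have hX' : `|X t - X t'| < r.
    by rewrite (lt_trans hX)// ltr_pdivrMr// ltr_pMr// ltr1n.
  have [_ h2] := hr (X t') t' hX' ht t'I.
  split => //; rewrite (le_lt_trans (ler_distD (p (X t) t) _ _))// (splitr e).
  by rewrite ltrD// distrC.
have hcov := cov R (0 : R)^'+ (fun d t => forall y, `|X t - y| < d ->
  U y /\ `|p (X t) t - p y t| < e) _ loc.
near (0 : R)^'+ => d.
have d0 : 0 < d by near: d; exact: nbhs_right_gt.
have hd : forall t, `[t0, t1]%classic t -> forall y, `|X t - y| < d ->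
    U y /\ `|p (X t) t - p y t| < e.
  by near: d; exact: hcov.
by exists d => // t y tI; exact: hd.
Unshelve. all: by end_near. Qed.

(** First-order Taylor expansion with a remainder uniform in time: [MVT_plane] evaluates the partial
    derivatives at points of the tube, where they differ from those at [X t] by less than [e]. *)
Lemma expansion_along p : space_C1 p -> forall e, 0 < e ->
  exists2 d, 0 < d & forall t y, t \in `[t0, t1] -> `|X t - y| < d ->
    U y /\
    `|p y t - p (X t) t - dlin p (X t) t (y - X t)| <= e * norm1 (y - X t).
Proof.
move=> [_ dp] e e0.
have [d d0 h0] := uniform_along (dp 0).1 e0.
have [d' d'0 h1] := uniform_along (dp 1).1 e0.
exists (Num.min d d'); first by rewrite lt_min d0.
move=> t y tI yd; have [yd0 yd1] : `|X t - y| < d /\ `|X t - y| < d'.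
  by move: yd; rewrite lt_min => /andP.
have [Uy _] := h0 t y tI yd0; split => //.
have der z : `|X t - z| < Num.min d d' ->
    forall i, derivable (p ^~ t) z (ebasis i).
  by rewrite lt_min => /andP[/(h0 t _ tI)[Uz _] _] i; exact: (dp i).2.
have [a [b [ad bd E]]] := MVT_plane der yd.
have /andP[ad0 _] : (`|X t - a| < d) && (`|X t - a| < d') by rewrite -lt_min.
have /andP[_ bd1] : (`|X t - b| < d) && (`|X t - b| < d') by rewrite -lt_min.
have [_ ha] := h0 t a tI ad0.
have [_ hb] := h1 t b tI bd1.
rewrite E /dlin; set A := 'D_(ebasis 0) _ a; set B := 'D_(ebasis 1) _ b.
set A' := 'D_(ebasis 0) _ (X t); set B' := 'D_(ebasis 1) _ (X t).
set u := (y - X t) 0 0; set w := (y - X t) 1 0.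
have -> : u * A + w * B - (A' * u + B' * w) = (A - A') * u + (B - B') * w by ring.
rewrite (le_trans (ler_normD _ _))// !normrM mulrDr lerD//.
  by rewrite ler_wpM2r// distrC ltW.
by rewrite ler_wpM2r// distrC ltW.
Qed.

End Along.

End SpaceTime.

(** * Limits of Cauchy families and stability of planar systems *)

Lemma near_punctured0 (R : realType) (d : R) :
  0 < d -> \forall k \near (0 : R)^', k != 0 /\ `|k| < d.
Proof.
move=> d0; rewrite near_withinE; apply/nbhs_normP; exists d => // k /=.
by rewrite sub0r normrN => ? ?.
Qed.

(** Here [h] is fixed while k tends to 0, so the radius [r] of the estimate is kept. In the
    application [r] is common to all times, although the limit is taken at each time separately. *)
Lemma cauchy_lim_dist (R : realType) (f : R -> R) :
  (forall e, 0 < e -> exists2 r, 0 < r & forall h k,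
     h != 0 -> `|h| < r -> k != 0 -> `|k| < r -> `|f h - f k| <= e) ->
  forall e r h, (forall k, k != 0 -> `|k| < r -> `|f h - f k| <= e) -> 0 < r ->
  `|f h - lim (f k @[k --> 0^'])| <= e.
Proof.
move=> cf e r h he r0.
have /cvgrPdist_lt fl : cvg (f k @[k --> 0^']).
  apply/cauchy_cvgP/cauchy_exP => e1 e10.
  have e2 : 0 < e1 / 2 by rewrite divr_gt0.
  have [r1 r10 hr1] := cf _ e2.
  exists (f (r1 / 2)).
  suff : \forall k \near (0 : R)^', ball (f (r1 / 2)) e1 (f k) by [].
  apply: filterS (near_punctured0 r10) => k [k0 kr].
  rewrite /ball/= (le_lt_trans (hr1 _ _ _ _ k0 kr))//.
  - by rewrite gt_eqF// divr_gt0.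
  - by rewrite gtr0_norm ?divr_gt0// ltr_pdivrMr// ltr_pMr// ltr1n.
  - by rewrite ltr_pdivrMr// ltr_pMr// ltr1n.
apply/ler_addgt0Pl => eta eta0.
near (0 : R)^' => k.
have [k0 kr] : k != 0 /\ `|k| < r by near: k; exact: near_punctured0.
rewrite (le_trans (ler_distD (f k) _ _))// addrC lerD ?he// ltW// distrC.
by near: k; exact: fl.
Unshelve. all: by end_near. Qed.

(* Gronwall for the squared length. The hypothesis is only needed inside the ball
   of squared radius [r], which the conclusion shows is never left. *)
Lemma linear_stability (R : realType) (a b K c r : R) (w0 w1 dw0 dw1 : R -> R) :
  0 <= K -> 0 <= c -> a <= b ->
  (forall t, t \in `]a, b[ -> is_derive t 1 w0 (dw0 t)) ->
  (forall t, t \in `]a, b[ -> is_derive t 1 w1 (dw1 t)) ->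
  {within `[a, b], continuous w0} -> {within `[a, b], continuous w1} ->
  (forall t, t \in `]a, b[ -> w0 t ^+ 2 + w1 t ^+ 2 < r ->
     `|dw0 t| <= K * (`|w0 t| + `|w1 t|) + c /\
     `|dw1 t| <= K * (`|w0 t| + `|w1 t|) + c) ->
  (w0 a ^+ 2 + w1 a ^+ 2 + 2 * c ^+ 2 * (b - a)) * expR ((4 * K + 1) * (b - a)) < r ->
  forall t, t \in `[a, b] -> w0 t ^+ 2 + w1 t ^+ 2 <=
    (w0 a ^+ 2 + w1 a ^+ 2 + 2 * c ^+ 2 * (b - a)) * expR ((4 * K + 1) * (b - a)).
Proof.
move=> K0 c0 ab d0 d1 c0' c1' bnd hr t tab.
have L0 : 0 <= 4 * K + 1 by rewrite addr_ge0// mulr_ge0.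
have C0 : 0 <= 2 * c ^+ 2 by rewrite mulr_ge0// sqr_ge0.
have z0 : 0 <= w0 a ^+ 2 + w1 a ^+ 2 by rewrite addr_ge0// sqr_ge0.
refine (@gronwall_threshold R a b _ _ r (fun s => w0 s ^+ 2 + w1 s ^+ 2)
  (fun s => 2 * w0 s * dw0 s + 2 * w1 s * dw1 s) L0 C0 z0 _ _ _ hr t tab).
- move=> s sab; have ? := d0 s sab; have ? := d1 s sab.
  apply: is_derive_eq.
  rewrite /GRing.scale/=; ring.
- by apply: within_continuousD; apply: within_continuousM.
- move=> s sab zr; have [b0 b1] := bnd s sab zr.
  have h0 : w0 s * dw0 s <= `|w0 s| * (K * (`|w0 s| + `|w1 s|) + c).
    by rewrite (le_trans (ler_norm _))// normrM ler_wpM2l.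
  have h1 : w1 s * dw1 s <= `|w1 s| * (K * (`|w0 s| + `|w1 s|) + c).
    by rewrite (le_trans (ler_norm _))// normrM ler_wpM2l.
  rewrite -(real_normK (num_real (w0 s))) -(real_normK (num_real (w1 s))).
  have -> : 2 * w0 s * dw0 s + 2 * w1 s * dw1 s =
    2 * (w0 s * dw0 s + w1 s * dw1 s) by ring.
  move: h0 h1; set A := `|w0 s|; set B := `|w1 s|.
  set P := w0 s * _; set Q := w1 s * _ => h0 h1.
  (* 2K(A+B)^2 equals 4K(A^2+B^2) - 2K(A-B)^2, and 2c(A+B) is at most 2c^2 + (A+B)^2/2, hence at
     most 2c^2 + A^2 + B^2. This is the origin of [4 * K + 1] and [2 * c ^+ 2]. *)
  have k1 : 0 <= K * (A - B) ^+ 2 by rewrite mulr_ge0// sqr_ge0.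
  have k2 : 0 <= (2 * c - (A + B)) ^+ 2 by exact: sqr_ge0.
  have k3 : 0 <= (A - B) ^+ 2 by exact: sqr_ge0.
  nra.
Qed.

(** * Dependence of the flow on the initial position *)

Section Flow.
Context {R : realType} (U : set (plane R)) (t0 t1 : R).
Variables (v : plane R -> R -> plane R) (F : R -> plane R -> plane R).
Hypothesis U_open : open U.
Hypothesis t0_lt_t1 : t0 < t1.
Hypothesis v_C1 : forall k, space_C1 U t0 t1 (fun x t => v x t k 0).
Hypothesis F_flow : flow_map U t0 t1 v F.

Lemma flow_in x t : U x -> t \in `[t0, t1] -> U (F t x).
Proof. by move=> Ux tI; have [_ /(_ t tI)[]] := F_flow Ux. Qed.

Lemma flow_start x : U x -> F t0 x = x.
Proof. by move=> Ux; have [] := F_flow Ux. Qed.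

Lemma flow_continuous x : U x -> {within `[t0, t1], continuous (F ^~ x)}.
Proof.
move=> Ux; apply: (@is_derive_in_continuous _ _ _ _ (fun t => v (F t x) t)) => t tI.
by have [_ /(_ t tI)[]] := F_flow Ux.
Qed.

Lemma flow_coord_continuous x k : U x ->
  {within `[t0, t1], continuous (fun t => F t x k 0)}.
Proof.
move=> Ux; apply: (@is_derive_in_continuous _ _ _ _ (fun t => v (F t x) t k 0)) => t tI.
apply: is_derive_in_coord.
by have [_ /(_ t tI)[]] := F_flow Ux.
Qed.

Lemma flow_coord_derive x t k : U x -> t \in `]t0, t1[ ->
  is_derive t 1 (fun s => F s x k 0) (v (F t x) t k 0).
Proof.
move=> Ux tI; apply: (is_derive_in_interior tI); apply: is_derive_in_coord.
by have [_ /(_ t (subset_itv_oo_cc tI))[]] := F_flow Ux.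
Qed.

Section Linearization.
Variable x0 : plane R.
Hypothesis Ux0 : U x0.

Let X_cont := flow_continuous Ux0.
Let X_in t := @flow_in x0 t Ux0.

Lemma gradient_bound : exists2 K, 0 <= K & forall t k i, t \in `[t0, t1] ->
  `|'D_(ebasis i) (fun x => v x t k 0) (F t x0)| <= K.
Proof.
have b k i := bounded_along U_open X_cont X_in ((v_C1 k).2 i).1.
have [A A0 hA] := b 0 0; have [B B0 hB] := b 0 1.
have [C C0 hC] := b 1 0; have [D D0 hD] := b 1 1.
exists (A + B + C + D); first by rewrite !addr_ge0.
have leA : A <= A + B + C + D by lra.
have leB : B <= A + B + C + D by lra.
have leC : C <= A + B + C + D by lra.
have leD : D <= A + B + C + D by lra.
move=> t k i tI; move: k i; apply: ord2P; apply: ord2P.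
- exact: le_trans (hA t tI) leA.
- exact: le_trans (hB t tI) leB.
- exact: le_trans (hC t tI) leC.
- exact: le_trans (hD t tI) leD.
Qed.

Lemma flow_expansion e : 0 < e -> exists2 d, 0 < d &
  forall t y k, t \in `[t0, t1] -> `|F t x0 - y| < d ->
  `|v y t k 0 - v (F t x0) t k 0
    - dlin (fun x t => v x t k 0) (F t x0) t (y - F t x0)|
      <= e * norm1 (y - F t x0).
Proof.
move=> e0.
have [d d0 h0] := expansion_along U_open X_cont X_in (v_C1 0) e0.
have [d' d'0 h1] := expansion_along U_open X_cont X_in (v_C1 1) e0.
exists (Num.min d d'); first by rewrite lt_min d0.
move=> t y k tI; rewrite lt_min => /andP[/(h0 t y tI)[_ H0] /(h1 t y tI)[_ H1]].
by move: k; apply: ord2P.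
Qed.

(** Lipschitz dependence on the initial position. Inside the tube two velocities differ by at most
    [K + 1] times the distance: [K] bounds the differential and 1 is the error taken in
    [flow_expansion]. The threshold given to [linear_stability] is the squared radius of the
    tube. *)
Lemma flow_stable : exists2 M, 0 < M & exists2 r, 0 < r &
  forall x, `|x0 - x| < r -> U x /\
    forall t, t \in `[t0, t1] -> norm1 (F t x - F t x0) <= M * norm1 (x - x0).
Proof.
have [K K0 hK] := gradient_bound.
have [d d0 hd] := flow_expansion ltr01.
pose E := expR ((4 * (K + 1) + 1) * (t1 - t0)).
have E1 : 1 <= E.
  rewrite -[leLHS]expR0 ler_expR mulr_ge0// ?subr_ge0 ?(ltW t0_lt_t1)//.
  by rewrite addr_ge0// mulr_ge0// addr_ge0.
have E0 : 0 < E by exact: lt_le_trans E1.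
have /nbhs_normP[u /= u0 hu] := open_nbhs_nbhs (conj U_open Ux0).
exists (2 * E); first by rewrite mulr_gt0.
(* If each coordinate of the initial difference is below r = d / (4E), its squared length times E is
   below 2 r^2 E, which is less than (4 E r)^2 = d^2 because E is at least 1. *)
exists (Num.min u (d / (4 * E))); first by rewrite lt_min u0 divr_gt0// mulr_gt0.
move=> x; rewrite lt_min => /andP[xu xr]; have Ux : U x by exact: hu.
split => // t tI.
set r := d / (4 * E) in xr.
have r0 : 0 < r by rewrite divr_gt0// mulr_gt0.
have rE : 4 * (E * r) = d by rewrite /r; field; rewrite gt_eqF.
have x0r i : `|x i 0 - x0 i 0| < r.
  move/norm_plane_lt : xr => /(_ r0 i).
  by rewrite distrC !mxE.
have zr : ((x 0 0 - x0 0 0) ^+ 2 + (x 1 0 - x0 1 0) ^+ 2) * E < d ^+ 2.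
  have A := x0r 0; have B := x0r 1.
  rewrite -(real_normK (num_real (x 0 0 - _))) -(real_normK (num_real (x 1 0 - _))).
  move: A B; set A := `|_|; set B := `|_| => hA hB.
  have A2 : A ^+ 2 <= r ^+ 2 by apply: lerXn2r; rewrite ?nnegrE ?normr_ge0 ?(ltW r0) ?(ltW hA).
  have B2 : B ^+ 2 <= r ^+ 2 by apply: lerXn2r; rewrite ?nnegrE ?normr_ge0 ?(ltW r0) ?(ltW hB).
  have r2 : 0 < r ^+ 2 by rewrite exprn_gt0.
  rewrite -rE; nra.
have st : 2 * 0 ^+ 2 * (t1 - t0) = 0 by rewrite expr0n/= mulr0 mul0r.
have S := @linear_stability R t0 t1 (K + 1) 0 (d ^+ 2)
  (fun s => F s x 0 0 - F s x0 0 0) (fun s => F s x 1 0 - F s x0 1 0)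
  (fun s => v (F s x) s 0 0 - v (F s x0) s 0 0)
  (fun s => v (F s x) s 1 0 - v (F s x0) s 1 0).
have {}S : (F t x 0 0 - F t x0 0 0) ^+ 2 + (F t x 1 0 - F t x0 1 0) ^+ 2 <=
    ((x 0 0 - x0 0 0) ^+ 2 + (x 1 0 - x0 1 0) ^+ 2) * E.
  move: S; rewrite /= !(flow_start Ux) !(flow_start Ux0) st addr0 => S.
  apply: S.
  - by rewrite addr_ge0.
  - by [].
  - exact: ltW.
  - by move=> s sI; apply: is_deriveB; exact: flow_coord_derive.
  - by move=> s sI; apply: is_deriveB; exact: flow_coord_derive.
  - by apply: within_continuousB; exact: flow_coord_continuous.
  - by apply: within_continuousB; exact: flow_coord_continuous.
  - move=> s sI zs; have sI' := subset_itv_oo_cc sI.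
    have near_d : `|F s x0 - F s x| < d.
      apply/norm_plane_lt => // i; rewrite !mxE distrC.
      rewrite -ltr_sqr ?nnegrE ?(ltW d0)// real_normK ?num_real//.
      apply: le_lt_trans zs; move: i; apply: ord2P.
        by rewrite lerDl sqr_ge0.
      by rewrite lerDr sqr_ge0.
    have vb k : `|v (F s x) s k 0 - v (F s x0) s k 0| <=
        (K + 1) * (`|F s x 0 0 - F s x0 0 0| + `|F s x 1 0 - F s x0 1 0|) + 0.
      have H := hd s (F s x) k sI' near_d.
      have G : `|dlin (fun x t => v x t k 0) (F s x0) s (F s x - F s x0)| <=
        K * norm1 (F s x - F s x0) by apply: dlin_bound => i; exact: hK.
      have -> : `|F s x 0 0 - F s x0 0 0| + `|F s x 1 0 - F s x0 1 0| =
        norm1 (F s x - F s x0) by rewrite /norm1 !mxE.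
      rewrite addr0 mulrDl -(subrK (dlin (fun x t => v x t k 0) (F s x0) s (F s x - F s x0))
        (v (F s x) s k 0 - v (F s x0) s k 0)) addrC (le_trans (ler_normD _ _))//.
      by rewrite lerD.
    by split; exact: vb.
  - exact: zr.
  - exact: tI.
have n1 := norm1_sqr_le (F t x - F t x0).
rewrite !mxE in n1.
rewrite -ler_sqr ?nnegrE ?norm1_ge0 ?mulr_ge0 ?norm1_ge0 ?(ltW E0)//.
apply: (le_trans n1).
have n0 : (x 0 0 - x0 0 0) ^+ 2 + (x 1 0 - x0 1 0) ^+ 2 <= norm1 (x - x0) ^+ 2.
  rewrite /norm1 !mxE.
  rewrite -(real_normK (num_real (x 0 0 - _))) -(real_normK (num_real (x 1 0 - _))).
  have := normr_ge0 (x 0 0 - x0 0 0); have := normr_ge0 (x 1 0 - x0 1 0).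
  by set A := `|_|; set B := `|_|; move=> B0 A0; nra.
set N := norm1 (x - x0) ^+ 2 in n0.
have N0 : 0 <= N by exact: sqr_ge0.
rewrite !exprMn -/N.
(* Gronwall yields 2NE, which is at most (2E)^2 N since E is at least 1. *)
apply: (@le_trans _ _ (2 * (N * E))).
  by rewrite ler_wpM2l// (le_trans S)// ler_wpM2r// ltW.
have k1 : 0 <= N * E * (E - 1) 
  by apply: mulr_ge0; [exact: mulr_ge0 N0 (ltW E0)|rewrite subr_ge0].
have k2 : 0 <= N * E by rewrite mulr_ge0// ltW.
have -> : 2 ^+ 2 = 4 :> R by rewrite -natrX.
nra.
Qed.

Lemma flow_step : exists2 M, 0 < M & exists2 r, 0 < r &
  forall i h, `|h| < r -> U (x0 + h *: ebasis i) /\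
    forall t, t \in `[t0, t1] ->
      norm1 (F t (x0 + h *: ebasis i) - F t x0) <= M * `|h|.
Proof.
have [M M0 [r r0 hr]] := flow_stable; exists M => //; exists r => // i h hh.
have n1 : norm1 (h *: ebasis i) = `|h| by rewrite norm1Z norm1_basis mulr1.
have := hr (x0 + h *: ebasis i).
have -> : x0 + h *: ebasis i - x0 = h *: ebasis i by rewrite addrC addKr.
rewrite n1; apply.
by rewrite opprD addNKr normrN; apply: norm1_lt; rewrite n1.
Qed.

(** A chain rule that precedes differentiability of the flow: a quotient stands where the derivative
    will be. For [p] a component of [v] this is the linearized equation up to an error. The
    expansion is taken with [e / M] because the flow moves by at most [M] times the step. *)
Lemma chain_quotient p : space_C1 U t0 t1 p -> forall e, 0 < e ->
  exists2 r, 0 < r & forall i h, h != 0 -> `|h| < r ->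
    forall t, t \in `[t0, t1] ->
    `|h^-1 * (p (F t (x0 + h *: ebasis i)) t - p (F t x0) t)
      - dlin p (F t x0) t (h^-1 *: (F t (x0 + h *: ebasis i) - F t x0))| <= e.
Proof.
move=> pC e e0; have [M M0 [r r0 hr]] := flow_step.
have eM : 0 < e / M by rewrite divr_gt0.
have [d d0 hd] := expansion_along U_open X_cont X_in pC eM.
exists (Num.min r (d / M)); first by rewrite lt_min r0 divr_gt0.
move=> i h h0; rewrite lt_min => /andP[hr' hdM] t tI.
have [_ /(_ t tI) nY] := hr i h hr'.
have /(hd t _ tI)[_ B] : `|F t x0 - F t (x0 + h *: ebasis i)| < d.
  rewrite distrC; apply: norm1_lt; apply: le_lt_trans nY _.
  by rewrite mulrC -ltr_pdivlMr.
rewrite dlinZ -mulrBr normrM normfV ler_pdivrMl ?normr_gt0//.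
apply: (le_trans B); apply: (le_trans (ler_wpM2l (ltW eM) nY)).
by rewrite mulrA divfK ?gt_eqF// mulrC.
Qed.

(* The difference quotients of the flow satisfy the linearized equation up to a
   small error, so two of them stay close: the derivative of the flow exists
   without solving the linearized equation. *)
Lemma flow_quotient_cauchy e : 0 < e ->
  exists2 r, 0 < r & forall i h h', h != 0 -> `|h| < r -> h' != 0 -> `|h'| < r ->
    forall t, t \in `[t0, t1] ->
    norm1 (h^-1 *: (F t (x0 + h *: ebasis i) - F t x0) -
           h'^-1 *: (F t (x0 + h' *: ebasis i) - F t x0)) <= e.
Proof.
move=> e0; have [K K0 hK] := gradient_bound.
have [M M0 [r r0 hr]] := flow_step.
pose T := t1 - t0; have T0 : 0 <= T by rewrite subr_ge0 ltW.
pose E := expR ((4 * K + 1) * T); have E0 : 0 < E by exact: expR_gt0.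
have TE0 : 0 <= T * E by rewrite mulr_ge0// ltW.
(* With zero initial value and forcing 2e', the squared length is at most 8 e'^2 T E, so the square
   of [norm1] is at most 16 e'^2 T E, hence at most (4 e' (T E + 1))^2 = e^2. *)
pose e' := e / (4 * (T * E + 1)).
have e'0 : 0 < e' by rewrite divr_gt0// mulr_gt0// ltr_wpDl.
have [r1 r10 h1] := chain_quotient (v_C1 0) e'0.
have [r2 r20 h2] := chain_quotient (v_C1 1) e'0.
exists (Num.min r (Num.min r1 r2)); first by rewrite !lt_min r0 r10.
move=> i h h' h0; rewrite !lt_min => /and3P[hr0 hr1 hr2] h'0 /and3P[hr0' hr1' hr2'] t tI.
have [Uy _] := hr i h hr0; have [Uy' _] := hr i h' hr0'.
set y := x0 + h *: ebasis i; set y' := x0 + h' *: ebasis i.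
pose w k s := h^-1 * (F s y k 0 - F s x0 k 0) - h'^-1 * (F s y' k 0 - F s x0 k 0).
pose dw k s := h^-1 * (v (F s y) s k 0 - v (F s x0) s k 0) -
  h'^-1 * (v (F s y') s k 0 - v (F s x0) s k 0).
(* At the initial time both quotients are the same basis vector. *)
have w_start k : w k t0 = 0.
  rewrite /w !flow_start// !mxE [_ + h * _]addrC addrK [_ + h' * _]addrC addrK.
  by rewrite !mulKf// subrr.
have wd k s : s \in `]t0, t1[ -> is_derive s 1 (w k) (dw k s).
  move=> sI; have ? := flow_coord_derive k Uy sI.
  have ? := flow_coord_derive k Uy' sI; have ? := flow_coord_derive k Ux0 sI.
  exact: is_derive_eq.
have wc k : {within `[t0, t1], continuous (w k)}.
  by apply: within_continuousB; apply: within_continuousM;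
    try exact: within_continuous_cst; apply: within_continuousB;
    exact: flow_coord_continuous.
pose W s := h^-1 *: (F s y - F s x0) - h'^-1 *: (F s y' - F s x0).
have WE s : norm1 (W s) = `|w 0 s| + `|w 1 s| by rewrite /norm1 !mxE.
have dwb k s : s \in `[t0, t1] ->
    `|dw k s| <= K * (`|w 0 s| + `|w 1 s|) + 2 * e'.
  move=> sI; rewrite -WE.
  have G : `|dlin (fun x t => v x t k 0) (F s x0) s (W s)| <= K * norm1 (W s).
    by apply: dlin_bound => j; exact: hK.
  have [A B] : `|h^-1 * (v (F s y) s k 0 - v (F s x0) s k 0) -
      dlin (fun x t => v x t k 0) (F s x0) s (h^-1 *: (F s y - F s x0))| <= e' /\
     `|h'^-1 * (v (F s y') s k 0 - v (F s x0) s k 0) -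
      dlin (fun x t => v x t k 0) (F s x0) s (h'^-1 *: (F s y' - F s x0))| <= e'.
    by move: k {G}; apply: ord2P; split;
      [exact: h1|exact: h1|exact: h2|exact: h2].
  move: G A B; rewrite dlinB /dw.
  set a := _ * (_ - _); set b := dlin _ _ _ _; set a' := _ * (_ - _).
  set b' := dlin _ _ _ _ => G A B.
  have -> : a - a' = (b - b') + ((a - b) - (a' - b')) by ring.
  rewrite (le_trans (ler_normD _ _))// lerD// (le_trans (ler_normB _ _))//.
  by rewrite mulr_natl mulr2n lerD.
(* Here the bound [dwb] holds at all times without any smallness of [w], so the threshold may be any
   number above the final bound; that bound plus 1 is taken. *)
have := @linear_stability R t0 t1 K (2 * e') (2 * (2 * e') ^+ 2 * T * E + 1)
  (w 0) (w 1) (dw 0) (dw 1) K0 _ (ltW t0_lt_t1) (wd 0) (wd 1) (wc 0) (wc 1).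
rewrite !w_start expr0n/= !add0r -/T -/E => S.
have {}S : w 0 t ^+ 2 + w 1 t ^+ 2 <= 2 * (2 * e') ^+ 2 * T * E.
  apply: S => //.
  - by rewrite mulr_ge0// ltW.
  - by move=> s /subset_itv_oo_cc sI _; split; exact: dwb.
  - by rewrite ltrDl.
rewrite -/(W t) -ler_sqr ?nnegrE ?norm1_ge0 ?(ltW e0)//.
apply: (le_trans (norm1_sqr_le _)).
have -> : W t 0 0 = w 0 t by rewrite !mxE.
have -> : W t 1 0 = w 1 t by rewrite !mxE.
apply: (le_trans (ler_wpM2l _ S)) => //.
have eE : e = 4 * e' * (T * E + 1).
  by rewrite /e'; field; rewrite gt_eqF// ltr_wpDl.
rewrite eE; have := sqr_ge0 e'; set q := e' ^+ 2 => q0.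
have -> : 2 * (2 * (2 * e') ^+ 2 * T * E) = 16 * q * (T * E) by rewrite /q; ring.
have -> : (4 * e' * (T * E + 1)) ^+ 2 = 16 * q * (T * E + 1) ^+ 2 by rewrite /q; ring.
move: TE0; set X := T * E => X0.
apply: ler_wpM2l; first exact: mulr_ge0.
have X2 := sqr_ge0 X; nra.
Qed.

(** At each time the quotients are Cauchy, so the limit hidden in [jac] exists; letting the second
    step of [flow_quotient_cauchy] tend to 0 keeps its radius, which is uniform in time. *)
Lemma flow_jac e : 0 < e ->
  exists2 r, 0 < r & forall i h, h != 0 -> `|h| < r ->
    forall t, t \in `[t0, t1] -> forall k,
    `|h^-1 * (F t (x0 + h *: ebasis i) k 0 - F t x0 k 0) - jac (F t) x0 k i| <= e.
Proof.
move=> e0; have [r r0 hr] := flow_quotient_cauchy e0; exists r => // i h h0 hh t tI k.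
have -> : jac (F t) x0 k i =
    lim (h^-1 * (F t (x0 + h *: ebasis i) k 0 - F t x0 k 0) @[h --> 0^']).
  rewrite mxE /derive.
  suff -> : (fun h => h^-1 * (F t (x0 + h *: ebasis i) k 0 - F t x0 k 0)) =
    (fun h => h^-1 *: (((fun y => F t y k 0) \o shift x0) (h *: ebasis i)
      - F t x0 k 0)) by [].
  by apply/funext => h1 /=; rewrite [h1 *: _ + _]addrC.
have cauchy_coord e1 : 0 < e1 -> exists2 r1, 0 < r1 & forall h1 h2,
    h1 != 0 -> `|h1| < r1 -> h2 != 0 -> `|h2| < r1 ->
    `|h1^-1 * (F t (x0 + h1 *: ebasis i) k 0 - F t x0 k 0) -
      h2^-1 * (F t (x0 + h2 *: ebasis i) k 0 - F t x0 k 0)| <= e1.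
  move=> e10; have [r1 r10 hr1] := flow_quotient_cauchy e10.
  exists r1 => // h1 h2 a b c d; apply: le_trans _ (hr1 i h1 h2 a b c d t tI).
  by apply: le_trans _ (coord_le_norm1 _ k); rewrite !mxE.
apply: (@cauchy_lim_dist _ (fun h => h^-1 * (F t (x0 + h *: ebasis i) k 0 - F t x0 k 0))
  cauchy_coord e r) => // h2 h20 h2r.
apply: le_trans _ (hr i h h2 h0 hh h20 h2r t tI).
by apply: le_trans _ (coord_le_norm1 _ k); rewrite !mxE.
Qed.

End Linearization.

End Flow.

(** * Differentiation under the temporal average *)

Section TemporalAverage.
Context {R : realType} (t0 t1 : R).
Hypothesis t0_lt_t1 : t0 < t1.
Implicit Types g : R -> R.

Let integrable_continuous g : {within `[t0, t1], continuous g} ->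
  lebesgue_measure.-integrable `[t0, t1] (EFin \o g).
Proof. by move=> gc; apply: continuous_compact_integrable => //; exact: segment_compact. Qed.

Lemma eq_tavg g g' : {in `[t0, t1], g =1 g'} -> tavg t0 t1 g = tavg t0 t1 g'.
Proof. by move=> E; congr (_ * _); apply: eq_Rintegral => t; rewrite inE; exact: E. Qed.

Lemma tavgB g g' : {within `[t0, t1], continuous g} ->
  {within `[t0, t1], continuous g'} ->
  tavg t0 t1 (fun t => g t - g' t) = tavg t0 t1 g - tavg t0 t1 g'.
Proof.
move=> gc gc'; rewrite /tavg.
have -> := @RintegralB _ _ _ lebesgue_measure _ g g' (measurable_itv `[t0, t1])
  (integrable_continuous gc) (integrable_continuous gc').
exact: mulrBr.
Qed.

Lemma tavgZ c g : {within `[t0, t1], continuous g} ->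
  tavg t0 t1 (fun t => c * g t) = c * tavg t0 t1 g.
Proof.
move=> gc; rewrite /tavg.
have -> := @RintegralZl _ _ _ lebesgue_measure _ g c (measurable_itv `[t0, t1])
  (integrable_continuous gc).
exact: mulrCA.
Qed.

Lemma tavgN g : {within `[t0, t1], continuous g} ->
  tavg t0 t1 (fun t => - g t) = - tavg t0 t1 g.
Proof.
by move=> gc; rewrite -mulN1r -tavgZ//; apply: eq_tavg => t _; rewrite mulN1r.
Qed.

Lemma tavg_bound g e : {within `[t0, t1], continuous g} ->
  (forall t, t \in `[t0, t1] -> `|g t| <= e) -> `|tavg t0 t1 g| <= e.
Proof.
move=> gc ge; have T0 : 0 < t1 - t0 by rewrite subr_gt0.
rewrite /tavg normrM gtr0_norm ?invr_gt0// mulrC ler_pdivrMr//.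
have gi := integrable_continuous gc.
apply: (le_trans (le_normr_Rintegral _ gi)) => //.
have -> : e * (t1 - t0) = \int[lebesgue_measure]_(t in `[t0, t1]) e.
  rewrite Rintegral_cst//; congr (_ * _).
  have /= -> := lebesgue_measure_itv `[t0, t1].
  by rewrite lte_fin t0_lt_t1.
apply: le_Rintegral => //.
- apply: integrable_continuous; apply/subspace_continuousP => t tI.
  by apply: cvg_norm; move/subspace_continuousP : gc; exact.
- exact/integrable_continuous/within_continuous_cst.
Qed.

(** Once the quotients are within [e] of [q] at all times, so are their averages. As [q] is known
    only as a uniform limit, its continuity is derived as well; it provides the integrability that
    linearity of the average requires. *)
Lemma derive_tavg (f : R -> R -> R) (q : R -> R) (r : R) : 0 < r ->
  (forall h, `|h| < r -> {within `[t0, t1], continuous (f h)}) ->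
  (forall e, 0 < e -> exists2 d, 0 < d & forall h, h != 0 -> `|h| < d ->
     forall t, t \in `[t0, t1] -> `|h^-1 * (f h t - f 0 t) - q t| <= e) ->
  {within `[t0, t1], continuous q} /\
  h^-1 * (tavg t0 t1 (f h) - tavg t0 t1 (f 0)) @[h --> 0^'] --> tavg t0 t1 q.
Proof.
move=> r0 fc fq.
have f0c : {within `[t0, t1], continuous (f 0)} by apply: fc; rewrite normr0.
have gc h : `|h| < r -> {within `[t0, t1], continuous (fun t => h^-1 * (f h t - f 0 t))}.
  move=> hr; apply: within_continuousM; first exact: within_continuous_cst.
  by apply: within_continuousB => //; exact: fc.
have qc : {within `[t0, t1], continuous q}.
  apply/subspace_continuousP => t tI; apply/cvgrPdist_lt => e e0.
  have e3 : 0 < e / 3 by rewrite divr_gt0.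
  have [d d0 hd] := fq _ e3.
  near (0 : R)^' => h.
  have [h0 hr] : h != 0 /\ `|h| < r by near: h; exact: near_punctured0.
  have [_ hhd] : h != 0 /\ `|h| < d by near: h; exact: near_punctured0.
  move/subspace_continuousP : (gc h hr) => /(_ t tI)/cvgrPdist_lt/(_ _ e3).
  rewrite !near_withinE; apply: filterS => s hs sI; have := hs sI.
  have := hd h h0 hhd t tI; have := hd h h0 hhd s sI.
  set a := h^-1 * _; set b := h^-1 * _; set u := q s; set w := q t => A B C.
  have -> : w - u = (b - a) + (a - u) - (b - w) by ring.
  rewrite (le_lt_trans (ler_normB _ _))// (le_lt_trans (lerD (ler_normD _ _) (lexx _)))//.
  by lra.
split => //; apply/cvgrPdist_le => e e0.
have [d d0 hd] := fq _ e0.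
have := near_punctured0 d0; have := near_punctured0 r0.
apply: filterS2 => h [h0 hr] [_ hhd].
rewrite distrC -tavgB; [|exact: fc|exact: f0c].
rewrite -tavgZ; last by apply: within_continuousB => //; exact: fc.
rewrite -tavgB; [|exact: gc|exact: qc].
apply: tavg_bound; first by apply: within_continuousB => //; exact: gc.
by move=> t tI; exact: hd.
Unshelve. all: by end_near. Qed.

End TemporalAverage.

(** * Determinant of the flow Jacobian and the chain rule along the flow *)

Lemma det_mx2 (R : comPzRingType) (A : 'M[R]_2) :
  \det A = A 0 0 * A 1 1 - A 0 1 * A 1 0.
Proof.
rewrite (expand_det_row _ 0) sum_ord2 /cofactor !det_mx11 !mxE/=.
rewrite expr0 mul1r expr1 mulN1r mulrN.
by congr (_ * A _ _ - _ * A _ _); apply: val_inj.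
Qed.

(** The bound [e <= 1] keeps b' within [M + 1], so that the error is linear in [e]. *)
Lemma prod_dist (R : realType) (a b a' b' M e : R) : `|a| <= M -> `|b| <= M ->
  `|a - a'| <= e -> `|b - b'| <= e -> e <= 1 ->
  `|a * b - a' * b'| <= (2 * M + 1) * e.
Proof.
move=> aM bM ae be e1.
have M0 : 0 <= M := le_trans (normr_ge0 a) aM.
have e0 : 0 <= e := le_trans (normr_ge0 _) ae.
have bM' : `|b'| <= M + 1.
  have -> : b' = b - (b - b') by ring.
  by rewrite (le_trans (ler_normB _ _))// lerD// (le_trans be).
have -> : a * b - a' * b' = a * (b - b') + (a - a') * b' by ring.
rewrite (le_trans (ler_normD _ _))// !normrM.
have -> : (2 * M + 1) * e = M * e + e * (M + 1) by ring.
by apply: lerD; apply: ler_pM.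
Qed.

Section FlowJacobian.
Context {R : realType} (U : set (plane R)) (t0 t1 : R).
Variables (v : plane R -> R -> plane R) (F : R -> plane R -> plane R).
Hypothesis U_open : open U.
Hypothesis t0_lt_t1 : t0 < t1.
Hypothesis v_C1 : forall k, space_C1 U t0 t1 (fun x t => v x t k 0).
Hypothesis F_flow : flow_map U t0 t1 v F.
Variable x0 : plane R.
Hypothesis Ux0 : U x0.

Let X_cont := flow_continuous F_flow Ux0.
Let X_in t := @flow_in _ _ _ _ _ _ F_flow x0 t Ux0.

Lemma flow_quotient_bound : exists2 M, 0 < M & exists2 r, 0 < r &
  forall i h, h != 0 -> `|h| < r -> U (x0 + h *: ebasis i) /\
    forall t k, t \in `[t0, t1] ->
      `|h^-1 * (F t (x0 + h *: ebasis i) k 0 - F t x0 k 0)| <= M.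
Proof.
have [M M0 [r r0 hr]] := flow_step U_open t0_lt_t1 v_C1 F_flow Ux0.
exists M => //; exists r => // i h h0 hh; have [Uy hy] := hr i h hh.
split => // t k tI; rewrite normrM normfV ler_pdivrMl ?normr_gt0// mulrC.
apply: le_trans _ (hy t tI).
by apply: le_trans _ (coord_le_norm1 _ k); rewrite !mxE.
Qed.

(* Liouville's formula at the level of difference quotients: their determinant
   starts at 1 and its derivative is the divergence up to a small error. *)
Lemma det_flow_jac : (forall x t, U x -> t \in `[t0, t1] ->
   'D_(ebasis 0) (fun x => v x t 0 0) x + 'D_(ebasis 1) (fun x => v x t 1 0) x = 0) ->
  forall t, t \in `[t0, t1] -> \det (jac (F t) x0) = 1.
Proof.
move=> div0 t tI; apply/eqP; rewrite -subr_eq0 -normr_eq0 eq_le normr_ge0 andbT.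
apply/ler_addgt0Pl => eta eta0; rewrite addr0.
have [M M0 [r r0 hM]] := flow_quotient_bound.
have T0 : 0 < t1 - t0 by rewrite subr_gt0.
(* First term: the determinant of the quotients drifts at rate at most [4 * M * e]. Second term: the
   cost of replacing the quotients by [jac] in its two products. *)
pose C := 4 * M * (t1 - t0) + 2 * (2 * M + 1).
have C0 : 0 < C by rewrite addr_gt0 ?mulr_gt0// addr_gt0// mulr_gt0.
pose e := Num.min 1 (eta / C).
have e0 : 0 < e by rewrite lt_min ltr01 divr_gt0.
have e1 : e <= 1 by rewrite ge_min lexx.
have eC : C * e <= eta by rewrite mulrC -ler_pdivlMr// ge_min lexx orbT.
have [r1 r10 h1] := chain_quotient U_open t0_lt_t1 v_C1 F_flow Ux0 (v_C1 0) e0.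
have [r2 r20 h2] := chain_quotient U_open t0_lt_t1 v_C1 F_flow Ux0 (v_C1 1) e0.
have [r3 r30 h3] := flow_jac U_open t0_lt_t1 v_C1 F_flow Ux0 e0.
pose m := Num.min (Num.min r r1) (Num.min r2 r3).
have m0 : 0 < m by rewrite !lt_min r0 r10 r20.
pose h := m / 2.
have h0 : h != 0 by rewrite gt_eqF// divr_gt0.
have : `|h| < m by rewrite gtr0_norm ?divr_gt0// ltr_pdivrMr// ltr_pMr// ltr1n.
rewrite !lt_min => /andP[/andP[hr hr1] /andP[hr2 hr3]].
have Uy i : U (x0 + h *: ebasis i) by exact: (hM i h h0 hr).1.
pose D i k s := h^-1 * (F s (x0 + h *: ebasis i) k 0 - F s x0 k 0).
pose dD i k s := h^-1 * (v (F s (x0 + h *: ebasis i)) s k 0 - v (F s x0) s k 0).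
have DM i k s : s \in `[t0, t1] -> `|D i k s| <= M by exact: (hM i h h0 hr).2.
have D_start i k : D i k t0 = (k == i)%:R.
  rewrite /D !(flow_start F_flow)// !mxE [_ + h * _]addrC addrK.
  by rewrite mulKf// andbT.
have Dd i k s : s \in `]t0, t1[ -> is_derive s 1 (D i k) (dD i k s).
  move=> sI; have ? := flow_coord_derive F_flow k (Uy i) sI.
  have ? := flow_coord_derive F_flow k Ux0 sI.
  exact: is_derive_eq.
have Dc i k : {within `[t0, t1], continuous (D i k)}.
  apply: within_continuousM; first exact: within_continuous_cst.
  by apply: within_continuousB; exact: (flow_coord_continuous F_flow).
pose A k i s := 'D_(ebasis i) (fun x => v x s k 0) (F s x0).
have err i k s : s \in `[t0, t1] ->
    `|dD i k s - (A k 0 s * D i 0 s + A k 1 s * D i 1 s)| <= e.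
  move=> sI.
  have -> : A k 0 s * D i 0 s + A k 1 s * D i 1 s =
     dlin (fun x t => v x t k 0) (F s x0) s (h^-1 *: (F s (x0 + h *: ebasis i) - F s x0)).
    by rewrite /dlin !mxE.
  by move: k; apply: ord2P; [exact: h1|exact: h2].
pose z s := D 0 0 s * D 1 1 s - D 1 0 s * D 0 1 s.
pose dz s := D 0 0 s * dD 1 1 s + D 1 1 s * dD 0 0 s
  - (D 1 0 s * dD 0 1 s + D 0 1 s * dD 1 0 s).
have zd s : s \in `]t0, t1[ -> is_derive s 1 z (dz s).
  move=> sI; have ? := Dd 0 0 s sI; have ? := Dd 0 1 s sI.
  have ? := Dd 1 0 s sI; have ? := Dd 1 1 s sI.
  exact: is_derive_eq.
have zc : {within `[t0, t1], continuous z}.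
  by apply: within_continuousB; exact: within_continuousM.
have zb s : s \in `]t0, t1[ -> `|dz s| <= 4 * M * e.
  move=> /subset_itv_oo_cc sI.
  have tr : A 0 0 s + A 1 1 s = 0 by apply: div0 => //; exact: X_in.
  have bnd a b : `|a| <= M -> `|b| <= e -> `|a * b| <= M * e.
    by move=> ? ?; rewrite normrM ler_pM.
  have b1 := bnd _ _ (DM 0 0 s sI) (err 1 1 s sI).
  have b2 := bnd _ _ (DM 1 1 s sI) (err 0 0 s sI).
  have b3 := bnd _ _ (DM 1 0 s sI) (err 0 1 s sI).
  have b4 := bnd _ _ (DM 0 1 s sI) (err 1 0 s sI).
  move: b1 b2 b3 b4; rewrite /dz.
  move: (A 0 0 s) (A 1 1 s) (A 0 1 s) (A 1 0 s) tr.
  move: (D 0 0 s) (D 0 1 s) (D 1 0 s) (D 1 1 s).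
  move: (dD 0 0 s) (dD 0 1 s) (dD 1 0 s) (dD 1 1 s).
  move=> p q u w a b c d A00 A11 A01 A10 tr b1 b2 b3 b4.
  (* If the quotients solved the linearized equation exactly, the derivative would be the trace of
     [A] times the determinant, hence 0; only the four error terms remain. *)
  have A11E : A11 = - A00 by apply/eqP; rewrite -addr_eq0 addrC tr.
  have -> : a * w + d * p - (c * q + b * u) =
    a * (w - (A10 * c + A11 * d)) + d * (p - (A00 * a + A01 * b))
    - (c * (q - (A10 * a + A11 * b)) + b * (u - (A00 * c + A01 * d))).
    by rewrite A11E; ring.
  apply: (le_trans (ler_normB _ _)).
  apply: (le_trans (lerD (ler_normD _ _) (ler_normD _ _))).
  by lra.
have z_start : z t0 = 1.
  by rewrite /z !D_start/= mulr1 mulr0 subr0.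
have z1 : `|z t - 1| <= 4 * M * e * (t1 - t0).
  have c0 : 0 <= 4 * M * e by rewrite !mulr_ge0// ltW.
  by have := is_derive_bound c0 zd zc zb tI; rewrite z_start.
have J i k : `|D i k t - jac (F t) x0 k i| <= e by exact: h3.
have zdet : `|z t - \det (jac (F t) x0)| <= 2 * (2 * M + 1) * e.
  rewrite det_mx2 /z.
  have P1 := prod_dist (DM 0 0 t tI) (DM 1 1 t tI) (J 0 0) (J 1 1) e1.
  have P2 := prod_dist (DM 1 0 t tI) (DM 0 1 t tI) (J 1 0) (J 0 1) e1.
  have sub2 (a b c d : R) : a - c - (b - d) = (a - b) - (c - d) by ring.
  rewrite sub2 (le_trans (ler_normB _ _))// -mulrA mulr_natl mulr2n.
  exact: lerD.
have E : \det (jac (F t) x0) - 1 = (z t - 1) - (z t - \det (jac (F t) x0)) by ring.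
rewrite E (le_trans (ler_normB _ _))// (le_trans _ eC)// /C; lra.
Qed.

(** The chain rule of [chain_quotient] costs [e / 2], and replacing the flow quotient by its limit
    costs another [e / 2]. *)
Lemma chain_uniform p : space_C1 U t0 t1 p -> forall i e, 0 < e ->
  exists2 r, 0 < r & forall h, h != 0 -> `|h| < r ->
    forall t, t \in `[t0, t1] ->
    `|h^-1 * (p (F t (x0 + h *: ebasis i)) t - p (F t x0) t)
      - dlin p (F t x0) t (col i (jac (F t) x0))| <= e.
Proof.
move=> pC i e e0.
have [K K0 hK] := bounded_along U_open X_cont X_in (pC.2 0).1.
have [K' K'0 hK'] := bounded_along U_open X_cont X_in (pC.2 1).1.
have e2 : 0 < e / 2 by rewrite divr_gt0.
(* Chosen so that the bound [K + K' + 1] on the derivatives times the bound 2e' on [norm1 W] is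
   [e / 2]. *)
pose e' := e / 2 / (2 * (K + K' + 1)).
have KK : 0 < 2 * (K + K' + 1) by rewrite mulr_gt0// ltr_wpDl// addr_ge0.
have e'0 : 0 < e' by rewrite divr_gt0.
have [r r0 hr] := chain_quotient U_open t0_lt_t1 v_C1 F_flow Ux0 pC e2.
have [r' r'0 hr'] := flow_jac U_open t0_lt_t1 v_C1 F_flow Ux0 e'0.
exists (Num.min r r'); first by rewrite lt_min r0.
move=> h h0; rewrite lt_min => /andP[hhr hhr'] t tI.
have A := hr i h h0 hhr t tI.
have kb j : `|'D_(ebasis j) (p ^~ t) (F t x0)| <= K + K' + 1.
  move: j; apply: ord2P.
    by apply: (le_trans (hK t tI)); rewrite -addrA lerDl addr_ge0.
  by apply: (le_trans (hK' t tI)); rewrite addrAC lerDr addr_ge0.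
pose W := h^-1 *: (F t (x0 + h *: ebasis i) - F t x0) - col i (jac (F t) x0).
have WB k : `|W k 0| <= e'.
  by have := hr' i h h0 hhr' t tI k; rewrite !mxE.
have nW : norm1 W <= 2 * e' by rewrite mulr_natl mulr2n lerD.
have B : `|dlin p (F t x0) t W| <= e / 2.
  apply: (le_trans (dlin_bound _ kb)).
  apply: (@le_trans _ _ ((K + K' + 1) * (2 * e'))).
    by rewrite ler_wpM2l// !addr_ge0.
  by rewrite le_eqVlt /e'; apply/orP; left; apply/eqP; field; rewrite gt_eqF// ltr_wpDl// addr_ge0.
move: A B; rewrite dlinB; set a := h^-1 * _; set b := dlin _ _ _ _; set c := dlin _ _ _ _.
move=> A B; have -> : a - c = (a - b) + (b - c) by ring.
by rewrite (le_trans (ler_normD _ _))// (splitr e) lerD.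
Qed.

(** The continuity part later lets [tavgN] move the sign in [Jmx] through the average. *)
Lemma grad_tavg_flow p : space_C1 U t0 t1 p -> forall i,
  {within `[t0, t1], continuous
    (fun t => dlin p (F t x0) t (col i (jac (F t) x0)))} /\
  'D_(ebasis i) (fun y => tavg t0 t1 (fun t => p (F t y) t)) x0 =
    tavg t0 t1 (fun t => dlin p (F t x0) t (col i (jac (F t) x0))).
Proof.
move=> pC i.
have [M M0 [r r0 hr]] := flow_step U_open t0_lt_t1 v_C1 F_flow Ux0.
have [||qc] := @derive_tavg R t0 t1 t0_lt_t1 (fun h t => p (F t (x0 + h *: ebasis i)) t)
  (fun t => dlin p (F t x0) t (col i (jac (F t) x0))) r r0.
- move=> h /(hr i)[Uy _].
  apply: (continuous_along U_open (flow_continuous F_flow Uy) _ pC.1) => t.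
  exact: (flow_in F_flow).
- move=> e e0; have [d d0 hd] := chain_uniform pC i e0.
  exists d => // h h0 hhd t tI; rewrite scale0r addr0; exact: hd.
rewrite scale0r addr0 => c; split => //.
rewrite /derive; apply/cvg_lim => //.
suff -> : (fun h => h^-1 *: (((fun y => tavg t0 t1 (fun t => p (F t y) t)) \o shift x0)
    (h *: ebasis i) - tavg t0 t1 (fun t => p (F t x0) t))) =
  (fun h => h^-1 * (tavg t0 t1 (fun t => p (F t (x0 + h *: ebasis i)) t) -
     tavg t0 t1 (fun t => p (F t x0) t))) by [].
by apply/funext => h /=; rewrite [h *: _ + _]addrC.
Qed.

End FlowJacobian.

(** * Space derivatives of the smooth potentials *)

Lemma eq_derive_on (R : realType) (U : set (plane R)) (f g : plane R -> R) x u :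
  open U -> U x -> {in U, f =1 g} -> 'D_u f x = 'D_u g x.
Proof.
move=> U_open Ux fg; apply: near_eq_derive.
by near=> y; apply: fg; rewrite inE; near: y; exact: open_nbhs_nbhs.
Unshelve. all: by end_near. Qed.

Lemma continuous_at_dist (R : realType) (V : normedModType R) (g : V -> R) x :
  (forall e, 0 < e -> exists2 r, 0 < r & forall y, `|x - y| < r ->
    `|g x - g y| < e) -> {for x, continuous g}.
Proof.
move=> h; apply/cvgrPdist_lt => e /h[r r0 hr].
by apply/nbhs_normP; exists r.
Qed.

Section SmoothFields.
Context {R : realType} (U : set (plane R)) (t0 t1 : R).
Hypothesis U_open : open U.
Implicit Types p q : plane R -> R -> R.

Lemma jointly_continuousD p q : jointly_continuous U t0 t1 p ->
  jointly_continuous U t0 t1 q ->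
  jointly_continuous U t0 t1 (fun x t => p x t + q x t).
Proof. exact: within_continuousD. Qed.

Lemma eq_jointly_continuous p q :
  (forall x t, U x -> t \in `[t0, t1] -> p x t = q x t) ->
  jointly_continuous U t0 t1 p -> jointly_continuous U t0 t1 q.
Proof.
move=> pq; apply: subspace_eq_continuous => -[x t]; rewrite inE => -[Ux tI].
exact: pq.
Qed.

Lemma space_C1N p : space_C1 U t0 t1 p -> space_C1 U t0 t1 (fun x t => - p x t).
Proof.
move=> [pc dp]; split; first exact: jointly_continuousN.
move=> i; have [dc pd] := dp i; split; last first.
  by move=> x t Ux tI; apply: derivableN; exact: pd.
apply: eq_jointly_continuous (jointly_continuousN dc) => x t Ux tI.
by rewrite -(deriveN (pd x t Ux tI)).
Qed.

Lemma space_C1D p q : space_C1 U t0 t1 p -> space_C1 U t0 t1 q ->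
  space_C1 U t0 t1 (fun x t => p x t + q x t).
Proof.
move=> [pc dp] [qc dq]; split; first exact: jointly_continuousD.
move=> i; have [dpc pd] := dp i; have [dqc qd] := dq i; split; last first.
  by move=> x t Ux tI; apply: derivableD; [exact: pd|exact: qd].
apply: eq_jointly_continuous (jointly_continuousD dpc dqc) => x t Ux tI.
by rewrite -(deriveD (pd x t Ux tI) (qd x t Ux tI)).
Qed.

Lemma space_continuous p x t : jointly_continuous U t0 t1 p -> U x ->
  t \in `[t0, t1] -> {for x, continuous (p ^~ t)}.
Proof.
move=> pc Ux tI; apply: continuous_at_dist => e e0.
have [r r0 hr] := jointly_continuousP U_open pc Ux tI e0.
exists r => // y xy.
by apply: (hr y t xy _ tI).2; rewrite subrr normr0.
Qed.

Variable f : plane R -> R -> R.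
Hypothesis f_smooth : smooth_on U t0 t1 f.

(** Words of space derivatives only; the head of [w] is the outermost one. *)
Local Notation D w := (foldr (pderiv t0 t1) f (map Some w)).

Lemma smooth_space_C1 w : space_C1 U t0 t1 (D w).
Proof.
split; first by have [] := f_smooth (map Some w).
move=> i; split; first by have [] := f_smooth (map Some (i :: w)).
by move=> x t Ux tI; exact: ((f_smooth (map Some w)).2 x t Ux tI).1.
Qed.

Lemma smooth_derivable w i x t : U x -> t \in `[t0, t1] ->
  derivable (D w ^~ t) x (ebasis i).
Proof. by move=> Ux tI; exact: ((smooth_space_C1 w).2 i).2. Qed.

Lemma smooth_derive_comm w i j x t : U x -> t \in `[t0, t1] ->
  D [:: i, j & w] x t = D [:: j, i & w] x t.
Proof.
move=> Ux tI; apply: derive_comm.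
- near=> y; have Uy : U y by near: y; exact: open_nbhs_nbhs.
  split; [exact: smooth_derivable|exact: smooth_derivable| |].
    exact: (smooth_derivable (w := j :: w)).
  exact: (smooth_derivable (w := i :: w)).
- exact: (space_continuous (smooth_space_C1 [:: i, j & w]).1).
- exact: (space_continuous (smooth_space_C1 [:: j, i & w]).1).
Unshelve. all: by end_near. Qed.

(** Two transpositions. The inner one is an identity on [U] only; it may be differentiated because
    [U] is open. *)
Lemma smooth_derive_comm2 i j x t : U x -> t \in `[t0, t1] ->
  D [:: i; i; j] x t = D [:: j; i; i] x t.
Proof.
move=> Ux tI; apply: etrans (smooth_derive_comm [:: i] i j Ux tI).
have E : {in U, D [:: i; j] ^~ t =1 D [:: j; i] ^~ t}.
  by move=> y; rewrite inE => Uy; exact: (smooth_derive_comm [::] i j Uy tI).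
exact: (eq_derive_on (ebasis i) U_open Ux E).
Qed.

Lemma Jmx_mul (w : plane R) :
  (Jmx *m w) 0 0 = - w 1 0 /\ (Jmx *m w) 1 0 = w 0 0.
Proof. by rewrite !mxE !sum_ord2 !mxE/=; split; ring. Qed.

Lemma field_of0 : (fun x t => field_of f x t 0 0) = D [:: 1].
Proof.
by apply/funext => x; apply/funext => t; rewrite mxE (Jmx_mul _).1 opprK mxE.
Qed.

Lemma field_of1 : (fun x t => field_of f x t 1 0) = (fun x t => - D [:: 0] x t).
Proof. by apply/funext => x; apply/funext => t; rewrite mxE (Jmx_mul _).2 mxE. Qed.

Lemma field_of_C1 k : space_C1 U t0 t1 (fun x t => field_of f x t k 0).
Proof.
move: k; apply: ord2P; first by rewrite field_of0; exact: smooth_space_C1.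
by rewrite field_of1; apply: space_C1N; exact: smooth_space_C1.
Qed.

Lemma field_of_div x t : U x -> t \in `[t0, t1] ->
  'D_(ebasis 0) (fun x => field_of f x t 0 0) x
  + 'D_(ebasis 1) (fun x => field_of f x t 1 0) x = 0.
Proof.
move=> Ux tI.
have -> : (fun x => field_of f x t 0 0) = D [:: 1] ^~ t.
  by apply/funext => y; rewrite -field_of0.
have -> : (fun x => field_of f x t 1 0) = - (D [:: 0] ^~ t).
  by apply/funext => y; exact: (congr1 (fun h => h y t) field_of1).
rewrite (deriveN (smooth_derivable (w := [:: 0]) (i := 1) Ux tI)).
by apply/eqP; rewrite subr_eq0; apply/eqP; exact: (smooth_derive_comm [::]).
Qed.

Lemma neg_laplacianE : neg_laplacian f = (fun x t => - (D [:: 0; 0] x t + D [:: 1; 1] x t)).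
Proof. by apply/funext => x; apply/funext => t; rewrite /neg_laplacian /laplacian sum_ord2. Qed.

Lemma neg_laplacian_C1 : space_C1 U t0 t1 (neg_laplacian f).
Proof.
by rewrite neg_laplacianE; apply: space_C1N; apply: space_C1D; exact: smooth_space_C1.
Qed.

Lemma derive_neg_laplacian i x t : U x -> t \in `[t0, t1] ->
  'D_(ebasis i) (neg_laplacian f ^~ t) x = - (D [:: i; 0; 0] x t + D [:: i; 1; 1] x t).
Proof.
move=> Ux tI; rewrite neg_laplacianE.
have d0 := smooth_derivable (w := [:: 0; 0]) (i := i) Ux tI.
have d1 := smooth_derivable (w := [:: 1; 1]) (i := i) Ux tI.
by rewrite -[RHS](congr1 -%R (deriveD d0 d1)) -(deriveN (derivableD d0 d1)).
Qed.

Lemma laplacianN w x t : U x -> t \in `[t0, t1] ->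
  laplacian (fun y => - D w y t) x = - laplacian (D w ^~ t) x.
Proof.
move=> Ux tI; rewrite /laplacian -sumrN; apply: eq_bigr => i _.
rewrite -(deriveN (smooth_derivable (w := i :: w) (i := i) Ux tI)).
apply: (@eq_derive_on _ U) => // y; rewrite inE => Uy.
by rewrite -[RHS](deriveN (smooth_derivable (w := w) (i := i) Uy tI)).
Qed.

Lemma vlaplacian_field_of x t : U x -> t \in `[t0, t1] ->
  vlaplacian (field_of f ^~ t) x = Jmx *m grad (neg_laplacian f ^~ t) x.
Proof.
move=> Ux tI; apply/matrixP => k l; rewrite ord1; move: k; apply: ord2P.
  rewrite (Jmx_mul _).1 !mxE derive_neg_laplacian// opprK.
  have -> : (fun y => field_of f y t 0 0) = D [:: 1] ^~ t.
    by apply/funext => y; rewrite -field_of0.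
  apply: etrans (sum_ord2 _) _.
  (* Only the mixed term is reordered; the pure third derivative is the same word on both sides. *)
  exact: (congr1 (+%R^~ _) (smooth_derive_comm2 0 1 Ux tI)).
rewrite (Jmx_mul _).2 !mxE derive_neg_laplacian//.
have -> : (fun y => field_of f y t 1 0) = (fun y => - D [:: 0] y t).
  by apply/funext => y; exact: (congr1 (fun h => h y t) field_of1).
apply: etrans (laplacianN [:: 0] Ux tI) _; apply: congr1.
apply: etrans (sum_ord2 _) _.
exact: (congr1 (+%R _) (smooth_derive_comm2 1 0 Ux tI)).
Qed.

End SmoothFields.

(** * The matrix identity and the two barrier equations *)

Section MatrixIdentity.
Context {R : realType}.
Implicit Types (A : 'M[R]_2) (w : plane R).

Lemma mul_Jmx_tr A : A *m Jmx *m A^T = \det A *: Jmx.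
Proof.
by apply/matrixP; apply: ord2P; apply: ord2P;
  rewrite det_mx2 !mxE !sum_ord2 !mxE !sum_ord2 !mxE/=; ring.
Qed.

Lemma det_invmx_Jmx A w : \det A = 1 ->
  \det A *: (invmx A *m (Jmx *m w)) = Jmx *m (A^T *m w).
Proof.
move=> detA; have uA : A \in unitmx by rewrite unitmxE detA unitr1.
(* The remaining [Jmx] is scaled by 1, read backwards as the determinant, so that it becomes A J A^T
   and the inverse cancels. *)
rewrite detA scale1r -[in LHS](scale1r Jmx) -detA -mul_Jmx_tr.
by rewrite -!mulmxA mulKmx.
Qed.

End MatrixIdentity.

(** An invariant manifold lies in [U], so tangency tests a field only there. *)
Lemma eq_invariant_manifold (R : realType) (U M : set (plane R))
    (f g : plane R -> plane R) : (forall x, U x -> f x = g x) ->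
  invariant_manifold U f M <-> invariant_manifold U g M.
Proof.
suff imp f' g' : (forall x, U x -> f' x = g' x) ->
    invariant_manifold U f' M -> invariant_manifold U g' M.
  by move=> fg; split; apply: imp => // x Ux; rewrite fg.
move=> fg [MU sM tM]; split => // p Mp.
by rewrite -fg; [exact: tM|exact: MU].
Qed.

Lemma lagrangian_fieldE (R : realType) (U : set (plane R)) (t0 t1 eta : R)
    (psi a : plane R -> R -> R) (F : R -> plane R -> plane R) (x0 : plane R) :
  open U -> t0 < t1 -> smooth_on U t0 t1 psi -> smooth_on U t0 t1 a ->
  flow_map U t0 t1 (velocity psi) F -> U x0 ->
  lagrangian_field t0 t1 eta a F x0 = eta *: (Jmx *m
    grad (fun y0 => tavg t0 t1 (fun t => current a (F t y0) t)) x0).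
Proof.
move=> U_open t01 psi_smooth a_smooth F_flow Ux0; congr (_ *: _).
have vC1 : forall k, space_C1 U t0 t1 (fun x t => velocity psi x t k 0).
  exact: field_of_C1.
have gtavg := grad_tavg_flow U_open t01 vC1 F_flow Ux0 (neg_laplacian_C1 a_smooth).
pose q i t := dlin (current a) (F t x0) t (col i (jac (F t) x0)).
(* The identity holds under the integral at each time: the Eulerian one is applied at [F t x0],
   which the flow keeps in [U]. *)
have E t : t \in `[t0, t1] ->
    \det (jac (F t) x0) *: pullback F t (diffusive_term a) x0 =
    Jmx *m \col_i q i t.
  move=> tI; have UX : U (F t x0) by exact: (flow_in F_flow).
  rewrite /pullback /diffusive_term (vlaplacian_field_of U_open a_smooth UX tI).
  rewrite det_invmx_Jmx; last first.
    apply: (det_flow_jac U_open t01 vC1 F_flow Ux0 _ tI) => x s Ux sI.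
    exact: (field_of_div U_open psi_smooth).
  congr (_ *m _); apply/matrixP => i l; rewrite ord1 !mxE sum_ord2 !mxE.
  by rewrite /q /dlin !mxE; congr (_ + _); rewrite mulrC.
apply/matrixP => k l; rewrite ord1; move: k; apply: ord2P.
  rewrite (Jmx_mul _).1 !mxE (gtavg 1).2 -(tavgN (gtavg 1).1).
  by apply: eq_tavg => t tI; rewrite E// (Jmx_mul _).1 mxE.
rewrite (Jmx_mul _).2 !mxE (gtavg 0).2.
by apply: eq_tavg => t tI; rewrite E// (Jmx_mul _).2 mxE.
Qed.

Theorem theorem1 (R : realType) (U : set (plane R)) (t0 t1 nu eta : R)
    (psi a : plane R -> R -> R) (F : R -> plane R -> plane R)
    (U_open : open U) (U_bounded : bounded_set U)
    (t0_lt_t1 : t0 < t1) (eta_ge0 : 0 <= eta)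
    (flow : mhd_flow U t0 t1 nu eta psi a)
    (F_flow : flow_map U t0 t1 (velocity psi) F) :
  (forall t, t \in `[t0, t1] -> forall M : set (plane R),
     eulerian_barrier U eta a t M <->
     invariant_manifold U
       (fun x => eta *: (Jmx *m grad (current a ^~ t) x)) M) /\
  (forall M0 : set (plane R),
     (exists M : R -> set (plane R),
        lagrangian_barrier U t0 t1 eta a F M /\ M t0 = M0) <->
     invariant_manifold U
       (fun x0 => eta *:
          (Jmx *m grad (fun y0 => tavg t0 t1 (fun t => current a (F t y0) t)) x0))
       M0).
Proof.
have [psi_smooth a_smooth _ _] := flow; split.
  move=> t tI M; apply: eq_invariant_manifold => x Ux; congr (_ *: _).
  exact: (vlaplacian_field_of U_open a_smooth).
have fE x0 : U x0 -> lagrangian_field t0 t1 eta a F x0 = _ :=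
  lagrangian_fieldE eta U_open t0_lt_t1 psi_smooth a_smooth F_flow.
(* The flow at [t0] is the identity on [U], so a material curve determines the initial set it comes
   from. *)
have start M0 : M0 `<=` U -> F t0 @` M0 = M0.
  move=> MU; apply/seteqP; split => [_ [x Mx <-]|x Mx].
    by rewrite (F_flow x (MU x Mx)).1.
  by exists x => //; rewrite (F_flow x (MU x Mx)).1.
have t0I : t0 \in `[t0, t1] by rewrite in_itv/= lexx ltW.
move=> M0; split.
  move=> [M [[M0' [inv MF]] Mt0]].
  have -> : M0 = M0' by rewrite -Mt0 MF// start//; case: inv.
  exact/(eq_invariant_manifold _ fE).
move=> inv; exists (fun t => F t @` M0); split; last by apply: start; case: inv.
by exists M0; split => //; apply/(eq_invariant_manifold _ fE).
Qed.
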